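(* Fuglede's conjecture holds in $\mathbb{Z}_2^d$ for every $d \leq 6$, and fails in $\mathbb{Z}_2^d$ for every $d \geq 10$. That is, for $d\le 6$ every nonempty $E\subseteq\mathbb{Z}_2^d$ tiles $\mathbb{Z}_2^d$ if and only if it is spectral, while for each $d\ge 10$ there is a nonempty $E\subseteq\mathbb{Z}_2^d$ for which this equivalence fails.
   Context: $\mathbb{Z}_2^d$ is the $d$-dimensional vector space over the field $\mathbb{Z}_2$. A nonempty subset $E\subseteq\mathbb{Z}_2^d$ tiles $\mathbb{Z}_2^d$ if there is $T\subseteq\mathbb{Z}_2^d$ with $\bigcup_{t\in T}(E+t)=\mathbb{Z}_2^d$ and $(E+t)\cap(E+t')=\varnothing$ for distinct $t,t'\in T$. A nonempty subset $E$ is spectral if there is $\Lambda\subseteq\mathbb{Z}_2^d$ such that the functions $x\mapsto e^{2\pi i(\lambda\cdot x)/2}=(-1)^{\lambda\cdot x}$, $\lambda\in\Lambda$, restricted to $E$, form an orthogonal basis of the space of all functions $E\to\mathbb{C}$ with inner product $\langle f,g\rangle=\sum_{x\in E}f(x)\overline{g(x)}$; here $\lambda\cdot x=\sum_i\lambda_ix_i$. *)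

(* Defs.v *)
From HB Require Import structures.
From mathcomp Require Import all_boot all_order all_algebra.
From mathcomp Require Import reals complex.

Set Implicit Arguments.
Unset Strict Implicit.
Unset Printing Implicit Defensive.

Import Order.TTheory GRing.Theory Num.Theory.

Local Open Scope ring_scope.

Definition translate (d : nat) (E : {set 'rV['F_2]_d}) (t : 'rV['F_2]_d) :
    {set 'rV['F_2]_d} :=
  [set x + t | x in E].

Definition tiles (d : nat) (E : {set 'rV['F_2]_d}) : Prop :=
  exists T : {set 'rV['F_2]_d},
    \bigcup_(t in T) translate E t = [set: 'rV['F_2]_d] /\
    {in T &, forall t t', t != t' -> translate E t :&: translate E t' = set0}.

Definition dot (d : nat) (l x : 'rV['F_2]_d) : 'F_2 :=
  \sum_i l 0 i * x 0 i.

Definition points (d : nat) (E : {set 'rV['F_2]_d}) : finType :=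
  {x : 'rV['F_2]_d | x \in E}.

(* The codomain is the regular algebra [R[i]^o], so that this is a [vectType]
   over [R[i]]. *)
Definition funs (R : realType) (d : nat) (E : {set 'rV['F_2]_d}) :
    vectType R[i] :=
  {ffun points E -> R[i]^o}.

(* The exponent is the representative of [dot l x] in {0, 1}, through the
   coercion from ['F_2] to [nat]; the value is e^(2 pi i (l . x) / 2). *)
Definition chi (R : realType) (d : nat) (E : {set 'rV['F_2]_d})
    (l : 'rV['F_2]_d) : funs R E :=
  [ffun x : points E => (-1) ^+ dot l (val x)].

Definition inner (R : realType) (d : nat) (E : {set 'rV['F_2]_d})
    (f g : funs R E) : R[i] :=
  \sum_(x : points E) f x * (g x)^*.

(* [basis_of] is applied to the sequence indexed by [L], not to its set of
   values: distinct elements of [L] must have distinct restrictions to [E]. *)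
Definition spectral (R : realType) (d : nat) (E : {set 'rV['F_2]_d}) : Prop :=
  exists L : {set 'rV['F_2]_d},
    {in L &, forall l l', l != l' -> inner (chi R E l) (chi R E l') = 0} /\
    basis_of fullv [seq chi R E l | l <- enum L].

(* Main.v *)
(* Write V for Z_2^d and ft E for the Fourier transform of the indicator function
   of E. A set E is spectral when some set L of size |E| has all its nonzero
   differences among the zeros of ft E. If the zeros of ft E contain a subspace U
   of size |E|, minus 0, then E is spectral (with spectrum U) and tiles V (with
   the annihilator of U), so for d <= 6 it suffices to find such a U whenever E
   tiles V or is spectral.

   Tilings E + T = V. The product ft E * ft T vanishes off 0, so a U on which
   ft T has no zero will do. If |T| <= 4, or if |T| = 8 and four points of T sum
   to 0, there is such a U of size |E|, because characters that agree on more than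
   half of T do not sum to 0 over T. If |E| <= 4, or if |E| = 8 and no four points
   of E sum to 0, the only even nonempty zero-sum subset of E is E itself (a
   zero-sum set of six points has a 16-element set of differences, each translate
   of which meets T at most once), and any bijection of E onto Z_2^k is induced by
   an affine map. Finally, if four points of E form an affine plane, then either E
   is an affine subspace, or T is periodic modulo the direction of the plane, which
   gives four points of T of sum 0.

   Spectral sets. The identity 1_E^2 = 1_E shows that the support A of ft E, if it
   contains a point a <> 0, contains a line {a, b, a + b}, unless |E| = |V|/2; a
   spectrum has at most one point in each coset of {0, a, b, a + b}, hence
   |E| <= |V|/4 <= 16. Sums of three or four rows of the Hadamard matrix of
   characters are controlled modulo 8: this excludes |E| = 12 and settles |E| = 8.
   For |E| = 16, either the spectrum L lies in a hyperplane and one argues as for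
   |E| = |V|/2, or 8 divides ft E everywhere. In the latter case, for x <> 0 in the
   support of ft L, at most four points of A are orthogonal to x, no three of
   these form a line, and so some y has y . a = 1 for each of them; U is the
   annihilator of {x, y}.

   For d >= 10, the twelve points 0, e_1, ..., e_10, e_1 + ... + e_10 have a
   spectrum read off from a Hadamard matrix of order 12, and 12 does not divide
   2^d. *)

Require Import Defs.
From HB Require Import structures.
From mathcomp Require Import all_boot all_order all_algebra.
From mathcomp Require Import reals complex.
From mathcomp Require Import zify ring.

Set Implicit Arguments.
Unset Strict Implicit.
Unset Printing Implicit Defensive.

Import Order.TTheory GRing.Theory Num.Theory.

Local Open Scope ring_scope.

(** * Characters of Z_2^d and the Fourier transform *)

Lemma F2_cases (a : 'F_2) : a = 0 \/ a = 1.
Proof. by case: a => [[|[|//]] lt_a]; [left | right]; apply: val_inj. Qed.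

Section Characters.

Variable d : nat.
Implicit Types (l m x y z : 'rV['F_2]_d) (E U : {set 'rV['F_2]_d}).

Lemma addxx x : x + x = 0.
Proof. by apply/rowP => i; rewrite !mxE; case: (F2_cases (x 0 i)) => ->; apply: val_inj. Qed.

Lemma oppx x : - x = x.
Proof. by apply/eqP; rewrite eq_sym -addr_eq0 addxx. Qed.

Lemma addxK x y : x + y + y = x.
Proof. by rewrite -addrA addxx addr0. Qed.

Lemma addKx x y : x + (x + y) = y.
Proof. by rewrite addrA addxx add0r. Qed.

Lemma addx_eq0 x y : (x + y == 0) = (x == y).
Proof. by rewrite addr_eq0 oppx. Qed.

Lemma dotC l x : dot l x = dot x l.
Proof. by apply: eq_bigr => i _; rewrite mulrC. Qed.

Lemma dotDl l m x : dot (l + m) x = dot l x + dot m x.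
Proof. by rewrite -big_split; apply: eq_bigr => i _; rewrite mxE mulrDl. Qed.

Lemma dotDr l x y : dot l (x + y) = dot l x + dot l y.
Proof. by rewrite dotC dotDl !(dotC l). Qed.

Lemma dot0l x : dot 0 x = 0.
Proof. by apply: big1 => i _; rewrite mxE mul0r. Qed.

Lemma dot_nondeg l : l != 0 -> exists x, dot l x = 1.
Proof.
move=> /eqP l0; have [i li|l_0] := pickP (fun i => l 0 i != 0); last first.
  by case: l0; apply/rowP => i; rewrite mxE; apply/eqP; rewrite -[_ == _]negbK l_0.
exists (delta_mx 0 i); rewrite /dot (bigD1 i) //= big1 => [|j ji].
  by rewrite mxE !eqxx mulr1 addr0; case: (F2_cases (l 0 i)) li => ->.
by rewrite mxE (negPf ji) andbF mulr0.
Qed.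

Definition chr l x : int := (-1) ^+ dot l x.

Lemma chrDl l m x : chr (l + m) x = chr l x * chr m x.
Proof.
rewrite /chr dotDl.
by case: (F2_cases (dot l x)) => ->; case: (F2_cases (dot m x)) => ->.
Qed.

Lemma chrC l x : chr l x = chr x l.
Proof. by rewrite /chr dotC. Qed.

Lemma chrDr l x y : chr l (x + y) = chr l x * chr l y.
Proof. by rewrite !(chrC l) chrDl. Qed.

Lemma chr0l x : chr 0 x = 1.
Proof. by rewrite /chr dot0l. Qed.

Lemma chr0r l : chr l 0 = 1.
Proof. by rewrite chrC chr0l. Qed.

Lemma chrE l x : chr l x = if dot l x == 0 then 1 else -1.
Proof. by rewrite /chr; case: (F2_cases (dot l x)) => ->. Qed.

Lemma chr_sq l x : chr l x * chr l x = 1.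
Proof. by rewrite chrE; case: ifP. Qed.

Lemma dot_neq0 l x : (dot l x != 0) = (dot l x == 1).
Proof. by case: (F2_cases (dot l x)) => ->. Qed.

Definition subspace U := 0 \in U /\ {in U &, forall u v, u + v \in U}.

Definition ann U : {set 'rV['F_2]_d} := [set z | [forall u in U, dot u z == 0]].

Lemma annP U z : reflect {in U, forall u, dot u z = 0} (z \in ann U).
Proof.
rewrite inE; apply: (iffP forall_inP) => h u /h; first by move/eqP.
by move=> ->.
Qed.

Lemma big_addv U u (F : 'rV['F_2]_d -> int) :
  subspace U -> u \in U -> \sum_(v in U) F v = \sum_(v in U) F (v + u).
Proof.
move=> [_ UD] uU; rewrite (reindex_inj (addIr u)) /=.
apply: eq_bigl => v; apply/idP/idP => [vuU|vU]; last exact: UD.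
by rewrite -(addxK v u); apply: UD.
Qed.

Lemma sum_chr_subspace U z :
  subspace U -> \sum_(u in U) chr u z = if z \in ann U then #|U|%:R else 0.
Proof.
move=> sU; case: ifPn => [/annP zU|].
  rewrite (eq_bigr (fun=> 1)) ?sumr_const // => u uU.
  by rewrite chrE zU ?eqxx.
rewrite inE negb_forall_in => /exists_inP[u uU uz].
have := big_addv (fun v => chr v z) sU uU.
under [in RHS]eq_bigr => v _ do rewrite chrDl (chrE u) (negPf uz).
rewrite -big_distrl /= mulrN1; set S := \sum_(u in U) chr u z; lia.
Qed.

Lemma subspaceT : subspace setT.
Proof. by split=> [|u v _ _]; rewrite inE. Qed.

Lemma annT : ann setT = [set 0].
Proof.
apply/setP => z; rewrite [RHS]inE; apply/annP/eqP => [h|-> u _]; last first.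
  by rewrite dotC dot0l.
apply/eqP; apply: contraT => /dot_nondeg[x].
by rewrite dotC h ?inE.
Qed.

Lemma card_rV : #|{: 'rV['F_2]_d}| = (2 ^ d)%N.
Proof. by rewrite card_mx card_Fp // mul1n. Qed.

Lemma sum_chr z : \sum_u chr u z = if z == 0 then (2 ^ d)%:R else 0.
Proof.
have := sum_chr_subspace z subspaceT.
by rewrite annT inE cardsT card_rV; under eq_bigl do rewrite inE.
Qed.

(** Kept in [int], since the characters take only the values 1 and -1; the congruences modulo 4 and
    8 for spectral sets rely on this. *)
Definition ft E l : int := \sum_(x in E) chr l x.

Lemma ft0 E : ft E 0 = #|E|%:R.
Proof. by rewrite /ft (eq_bigr (fun=> 1)) ?sumr_const // => x _; rewrite chr0l. Qed.

(** Poisson summation over [U]. *)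
Lemma sum_ft_subspace E U z : subspace U ->
  \sum_(u in U) ft E u * chr u z = (#|U| * #|[set e in E | e + z \in ann U]|)%:R.
Proof.
move=> sU; under eq_bigr => u _ do rewrite /ft big_distrl /=.
rewrite exchange_big /=.
under eq_bigr => x _.
  under eq_bigr => u _ do rewrite -chrDr.
  rewrite sum_chr_subspace //.
over.
rewrite -big_mkcondr /= sumr_const -mulrnA; congr (1 *+ (_ * _)%N).
by rewrite cardsE.
Qed.

(** The Fourier form of 1_E^2 = 1_E: summing over [a] kills every pair of distinct points [x],
    [y]. *)
Lemma ft_conv E m : \sum_a ft E a * ft E (a + m) = (2 ^ d)%:R * ft E m.
Proof.
under eq_bigr => a _ do rewrite /ft big_distrlr /=.
rewrite exchange_big /= big_distrr /=; apply: eq_bigr => x xE.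
rewrite exchange_big /= (bigD1 x) //= [X in _ + X]big1 ?addr0 => [|y /andP[_ yx]].
  under eq_bigr => a _ do rewrite chrDl mulrA chr_sq mul1r.
  by rewrite sumr_const card_rV mulr_natl.
under eq_bigr => a _ do rewrite chrDl mulrA -chrDr.
by rewrite -big_distrl /= sum_chr addx_eq0 eq_sym (negPf yx) mul0r.
Qed.

(** The squares of [ft E] transform to the autocorrelation of [E]; [t = 0] is Parseval's
    identity. *)
Lemma ft_corr E t :
  \sum_m ft E m ^+ 2 * chr m t = (2 ^ d * #|[set e in E | e + t \in E]|)%:R.
Proof.
under eq_bigr => a _ do rewrite expr2 /ft big_distrlr big_distrl /=.
rewrite exchange_big /= natrM.
transitivity (\sum_(x in E) \sum_(y in E) \sum_a chr a (x + y + t)).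
  apply: eq_bigr => x xE; rewrite exchange_big /=; apply: eq_bigr => a _.
  by rewrite big_distrl /=; apply: eq_bigr => y _; rewrite !chrDr.
transitivity (\sum_(x in E) (2 ^ d)%:R * (x + t \in E)%:R : int); last first.
  rewrite -big_distrr /= -natr_sum; congr (_ * _%:R).
  by rewrite -sum1_card big_mkcond [RHS]big_mkcond; apply: eq_bigr => x _;
     rewrite inE; case: (x \in E); case: (x + t \in E).
apply: eq_bigr => x xE.
under eq_bigr => y _ do rewrite sum_chr addrAC addx_eq0.
rewrite -big_mkcondr /=; case: (boolP (x + t \in E)) => xtE; last first.
  rewrite big1 ?mulr0 // => y /andP[yE /eqP xy].
  by rewrite xy yE in xtE.
rewrite (bigD1 (x + t)) ?xtE ?eqxx //= big1 ?addr0 ?mulr1 // => y.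
by rewrite eq_sym => /andP[/andP[_ ->]].
Qed.

End Characters.

(** * Spectra, tilings and subspaces of zeros *)

Section Good.

Variable d : nat.
Implicit Types (l m x y z : 'rV['F_2]_d) (E T U L : {set 'rV['F_2]_d}).

(** The inequality suits kernels, whose size is bounded below by counting equations; for nonempty
    [E] it becomes an equality by [good_count]. *)
Definition good E := exists U,
  [/\ subspace U, (#|E| <= #|U|)%N & {in U, forall u, u != 0 -> ft E u = 0}].

(** In Poisson summation only the term at 0 survives, so |U| times the count is |E| for every [z]. A
    point of [E] taken as [z] makes the count positive, whence |U| <= |E|. *)
Lemma good_count E U : subspace U -> (#|E| <= #|U|)%N ->
    {in U, forall u, u != 0 -> ft E u = 0} -> E != set0 ->
  #|U| = #|E| /\ forall z, #|[set e in E | e + z \in ann U]| = 1%N.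
Proof.
move=> sU leEU U0 /set0Pn[e eE].
have cardE z : (#|U| * #|[set e in E | (e + z)%R \in ann U]| = #|E|)%N.
  apply/eqP; rewrite -(eqr_nat int) -sum_ft_subspace // (bigD1 0) /=; last exact: sU.1.
  rewrite ft0 chr0l mulr1 big1 ?addr0 // => u /andP[uU u0].
  by rewrite U0 ?mul0r.
have c0 : (0 < #|[set e' in E | (e' + e)%R \in ann U]|)%N.
  apply/card_gt0P; exists e; rewrite inE eE addxx; apply/annP => u _.
  by rewrite dotC dot0l.
have eqUE : #|U| = #|E|.
  apply/eqP; rewrite eqn_leq leEU andbT -(cardE e).
  by rewrite leq_pmulr.
split=> // z; have := cardE z; rewrite eqUE.
have : (0 < #|E|)%N by apply/card_gt0P; exists e.
by move=> E0 /eqP; rewrite -[X in _ == X]muln1 eqn_pmul2l // => /eqP.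
Qed.

Lemma good_tiles E : E != set0 -> good E -> tiles E.
Proof.
move=> E0 [U [sU leEU U0]]; have [_ count1] := good_count sU leEU U0 E0.
exists (ann U); split.
  apply/setP => z; rewrite inE; apply/bigcupP.
  have /card_gt0P[e] : (0 < #|[set e in E | (e + z)%R \in ann U]|)%N by rewrite count1.
  rewrite inE => /andP[eE ezU]; exists (e + z) => //.
  by apply/imsetP; exists e; rewrite // addKx.
move=> t t' tU t'U tt'; apply/setP => z; rewrite inE [RHS]inE.
apply/negP => /andP[/imsetP[e eE ze] /imsetP[e' e'E ze']].
have /eqP/cards1P[c cE] := count1 z.
have : e \in [set c] by rewrite -cE inE eE ze addKx.
have : e' \in [set c] by rewrite -cE inE e'E ze' addKx.
rewrite !inE => /eqP e'c /eqP ec; move: tt'.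
by rewrite -(addKx e t) -ze -(addKx e' t') -ze' ec e'c eqxx.
Qed.

Definition direct E T := {in E &, forall e e', {in T &, forall t t',
  e + t = e' + t' -> e = e' /\ t = t'}}.

Lemma direct_inj E T : direct E T -> {in setX E T &, injective (fun p => p.1 + p.2)}.
Proof.
move=> dET [e t] [e' t'] /= /setXP[eE tT] /setXP[e'E t'T] eq.
by have [-> ->] := dET e e' eE e'E t t' tT t'T eq.
Qed.

Lemma direct_leq E T : direct E T -> (#|E| * #|T| <= 2 ^ d)%N.
Proof.
move=> dET; rewrite -cardsX -(card_in_imset (direct_inj dET)) -(card_rV d).
exact: max_card.
Qed.

Lemma tiles_direct E : tiles E -> exists2 T, direct E T & (#|E| * #|T| = 2 ^ d)%N.
Proof.
case=> T [cov disj]; exists T.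
  move=> e e' eE e'E t t' tT t'T eq.
  have [tt'|tt'] := eqVneq t t'; first by move: eq; rewrite tt' => /addIr.
  have := disj t t' tT t'T tt'; move/setP/(_ (e + t)); rewrite !inE => /negP[].
  by apply/andP; split; apply/imsetP; [exists e | exists e'].
apply/eqP; rewrite eqn_leq; apply/andP; split.
  apply: direct_leq => e e' eE e'E t t' tT t'T eq.
  have [tt'|tt'] := eqVneq t t'; first by move: eq; rewrite tt' => /addIr.
  have := disj t t' tT t'T tt'; move/setP/(_ (e + t)); rewrite !inE => /negP[].
  by apply/andP; split; apply/imsetP; [exists e | exists e'].
rewrite -cardsX; apply: leq_trans (leq_imset_card (fun p => p.1 + p.2) _).
rewrite -(card_rV d) -cardsT; apply: subset_leq_card; rewrite -cov.
apply/subsetP => z /bigcupP[t tT /imsetP[e eE ->]]; apply/imsetP.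
by exists (e, t); rewrite // inE eE.
Qed.

Lemma direct_ft E T l : direct E T -> (#|E| * #|T| = 2 ^ d)%N -> l != 0 ->
  ft E l * ft T l = 0.
Proof.
move=> dET cardET l0; have := sum_chr l; rewrite (negPf l0) => <-.
have imT : [set p.1 + p.2 | p in setX E T] = setT.
  apply/eqP; rewrite eqEcard subsetT cardsT card_rV.
  by rewrite (card_in_imset (direct_inj dET)) cardsX cardET leqnn.
transitivity (\sum_(z in [set p.1 + p.2 | p in setX E T]) chr l z).
  rewrite (big_imset _ (direct_inj dET)) /=.
  rewrite /ft big_distrlr /= pair_big /=.
  by apply: eq_big => [[e t]|[e t] _]; rewrite ?inE ?chrDr.
by rewrite imT; apply: eq_big => z; rewrite ?inE // chrC.
Qed.

(** Nonzero orthogonal functions are independent, so the cardinality stands in for the basis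
    condition; see [spectralP]. *)
Definition spectrum E L := #|L| = #|E| /\
  {in L &, forall l l', l != l' -> ft E (l + l') = 0}.

Lemma good_spectrum E : E != set0 -> good E -> exists L, spectrum E L.
Proof.
move=> E0 [U [sU leEU U0]]; have [cardU _] := good_count sU leEU U0 E0.
exists U; split=> // u v uU vU uv; apply: U0; first exact: sU.2.
by rewrite addx_eq0.
Qed.

End Good.

(** * Complex orthogonal bases and integer Fourier transforms *)

Section Spectral.

Variables (R : realType) (d : nat).
Implicit Types (l : 'rV['F_2]_d) (E L : {set 'rV['F_2]_d}).

Lemma inner_chi E l l' : inner (chi R E l) (chi R E l') = (ft E (l + l'))%:~R.
Proof.
rewrite /inner /ft rmorph_sum /= [RHS]big_sub /=. apply: eq_bigr => x _.
rewrite !ffunE /chr dotDl rmorphXn rmorphN1.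
case: (F2_cases (dot l (val x))) => ->; case: (F2_cases (dot l' (val x))) => ->;
  rewrite /= ?expr0 ?expr1 ?rmorphN ?rmorph1 ?mulr1 ?mul1r ?mulrNN ?mulr1 //.
Qed.

Lemma dim_funs E : \dim (fullv : {vspace funs R E}) = #|E|.
Proof. by rewrite dimvf /dim /= card_sig muln1. Qed.

Lemma spectralP E : spectral R E <-> exists L, spectrum E L.
Proof.
split=> [[L [orth bas]] | [L [cardL orth]]].
  exists L; split=> [|l l' lL l'L ll'].
    have := @size_basis _ _ fullv _ (in_tuple [seq chi R E l | l <- enum L]) bas.
    by rewrite dim_funs /= size_map -cardE.
  by apply/eqP; rewrite -(intr_eq0 R[i]) -inner_chi orth.
have orthR : {in L &, forall l l', l != l' -> inner (chi R E l) (chi R E l') = 0}.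
  by move=> l l' lL l'L ll'; rewrite inner_chi orth.
exists L; split=> //.
rewrite basisEfree subvf dim_funs size_map -cardE cardL leqnn !andbT.
have fP := @freeP _ (funs R E) _ (in_tuple [seq chi R E l | l <- enum L]).
apply/fP => k sumk0 i {fP}.
have lt_L (j : 'I_(size [seq chi R E l | l <- enum L])) : (j < size (enum L))%N.
  by rewrite -(size_map (chi R E)).
have memL (j : 'I_(size [seq chi R E l | l <- enum L])) : nth 0 (enum L) j \in L.
  by rewrite -mem_enum mem_nth ?lt_L.
pose g := chi R E (nth 0 (enum L) i).
have innerZ (j : 'I_(size [seq chi R E l | l <- enum L])) :
    \sum_x (k j *: (in_tuple [seq chi R E l | l <- enum L])`_j : funs R E) x * (g x)^*
      = k j * (ft E (nth 0 (enum L) j + nth 0 (enum L) i))%:~R.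
  rewrite -inner_chi /inner big_distrr /=; apply: eq_bigr => x _.
  by rewrite (nth_map 0) ?lt_L // [in LHS]ffunE mulrA.
(* Pairing the vanishing combination with [g] leaves only [k i] times |E|, and |E| = |L| is not
   0. *)
have /(congr1 (fun f : funs R E => inner f g)) := sumk0.
rewrite /inner; under eq_bigr => x _ do rewrite sum_ffunE big_distrl /=.
rewrite exchange_big /=.
under eq_bigr => j _ do rewrite innerZ.
rewrite [RHS]big1 => [|x _]; last by rewrite ffunE mul0r.
rewrite (bigD1 i) //= big1 ?addr0 => [|j ji]; last first.
  by rewrite orth ?mulr0 ?memL // nth_uniq ?enum_uniq ?lt_L.
rewrite addxx ft0 => /eqP; rewrite mulf_eq0 => /orP[/eqP //|].
rewrite intr_eq0 pnatr_eq0 -cardL cardE => /eqP sz0.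
by have := lt_L i; rewrite sz0.
Qed.


End Spectral.

(** * Linear equations over F_2 *)

Lemma mulrn_odd (V : zmodType) (x : V) n : x + x = 0 -> x *+ n = x *+ odd n.
Proof.
by move=> xx; rewrite -{1}(odd_double_half n) mulrnDr -mul2n mulrnA mulr2n xx mul0rn addr0.
Qed.

Lemma F2_addxx (a : 'F_2) : a + a = 0.
Proof. by case: (F2_cases a) => ->; apply: val_inj. Qed.

Section Tools.

Variable d : nat.
Implicit Types (l m x y z : 'rV['F_2]_d) (E T U L C : {set 'rV['F_2]_d}).

Definition ker (s : seq 'rV['F_2]_d) : {set 'rV['F_2]_d} :=
  [set u | all (fun c => dot u c == 0) s].

Lemma subspace_halve U x : subspace U ->
  subspace [set u in U | dot u x == 0] /\
  (#|U| <= 2 * #|[set u in U | dot u x == 0%R]|)%N.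
Proof.
move=> [U0 UD]; split.
  split=> [|u v]; first by rewrite inE U0 dot0l.
  rewrite !inE => /andP[uU /eqP ux] /andP[vU /eqP vx].
  by rewrite UD // dotDl ux vx addr0 eqxx.
set W := [set u in U | _].
rewrite -(cardsID W U) mul2n -addnn.
apply: leq_add; first by rewrite subset_leq_card ?subsetIr.
have [UW0|[u0]] := set_0Vmem (U :\: W); first by rewrite UW0 cards0.
rewrite !inE => /andP[u0W u0U].
rewrite -(card_imset _ (addIr u0)); apply/subset_leq_card/subsetP => _ /imsetP[u uUW ->].
move: u0W uUW; rewrite !inE u0U /= => u0x /andP[ux uU]; move: ux.
rewrite uU UD // dotDl /=; move: u0x; rewrite !dot_neq0 => /eqP-> /eqP->.
by rewrite F2_addxx.
Qed.

Lemma subspace_ker s : subspace (ker s).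
Proof.
split=> [|u v]; rewrite ?inE; first by apply/allP => c _; rewrite dot0l.
move=> /allP us /allP vs; apply/allP => c cs.
by rewrite dotDl (eqP (us c cs)) (eqP (vs c cs)) addr0.
Qed.

Lemma card_ker s : (2 ^ d <= 2 ^ size s * #|ker s|)%N.
Proof.
elim: s => [|c s IHs] /=.
  by rewrite mul1n -(card_rV d) -cardsT; apply/subset_leq_card/subsetP => u; rewrite !inE.
apply: (leq_trans IHs); rewrite expnSr -mulnA leq_mul2l; apply/orP; right.
have [_ /leq_trans-> //] := subspace_halve c (subspace_ker s).
by rewrite leq_mul2l subset_leq_card //; apply/subsetP => u; rewrite !inE andbC.
Qed.

Lemma norm_chr l x : `|chr l x| = 1.
Proof. by rewrite chrE; case: ifP. Qed.

(* A set most of whose points agree on [u] cannot be balanced by the others. *)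
Lemma ft_concentrated T C u c0 : C \subset T -> (#|T| < 2 * #|C|)%N ->
  {in C, forall c, dot u c = dot u c0} -> ft T u != 0.
Proof.
move=> CT ltTC uC; apply/eqP; rewrite /ft (big_setID C) /= (setIidPr CT).
rewrite (eq_bigr (fun=> chr u c0)) => [|c cC]; last by rewrite !chrE uC.
rewrite sumr_const => /eqP; rewrite addr_eq0 => /eqP eq.
have := ler_norm_sum (index_enum _) (chr u) (mem (T :\: C)).
have -> : \sum_(i in T :\: C) `|chr u i| = #|T :\: C|%:R.
  by rewrite (eq_bigr (fun=> 1)) ?sumr_const // => c _; rewrite norm_chr.
have -> : `|\sum_(i in T :\: C) chr u i| = #|C|%:R.
  by rewrite -normrN -eq normrMn norm_chr.
rewrite ler_nat cardsD (setIidPr CT); have := subset_leq_card CT; lia.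
Qed.

(** By [ft_concentrated], [ft T] has no zero on [ker s], so [ft E] vanishes there off 0; each
    equation in [s] at most halves the kernel. *)
Lemma good_concentrated E T s C c0 : direct E T -> (#|E| * #|T| = 2 ^ d)%N ->
    (2 ^ size s <= #|T|)%N -> C \subset T -> (#|T| < 2 * #|C|)%N ->
    {in ker s, forall u, {in C, forall c, dot u c = dot u c0}} -> good E.
Proof.
move=> dET cET leT CT ltTC kerC; exists (ker s); split; first exact: subspace_ker.
  have := card_ker s; rewrite -cET mulnC => le.
  have T0 : (0 < #|T|)%N by apply: leq_trans leT; rewrite expn_gt0.
  by rewrite -(leq_pmul2l T0); apply: (leq_trans le); rewrite leq_mul2r leT orbT.
move=> u uU u0; have := direct_ft dET cET u0.
move/eqP; rewrite mulf_eq0 => /orP[/eqP //|].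
by rewrite (negPf (ft_concentrated CT ltTC (kerC u uU))).
Qed.

Lemma dot_sumr (I : finType) (J : {set I}) (v : I -> 'rV['F_2]_d) y :
  dot y (\sum_(i in J) v i) = \sum_(i in J) dot y (v i).
Proof. by apply: (big_morph _ (@dotDr d y)); rewrite dotC dot0l. Qed.

Definition sgn2 (a : 'F_2) : int := (-1) ^+ a.

Lemma sgn2D a b : sgn2 (a + b) = sgn2 a * sgn2 b.
Proof. by rewrite /sgn2; case: (F2_cases a) => ->; case: (F2_cases b) => ->. Qed.

(* The number of solutions is a sum over [J] of characters; under the
   hypothesis all its terms are nonnegative, and [J = set0] gives [2 ^ d]. *)
Lemma solve (I : finType) (A : {set I}) (v : I -> 'rV['F_2]_d) (f : I -> 'F_2) :
    (forall J : {set I}, J \subset A -> \sum_(i in J) v i = 0 -> \sum_(i in J) f i = 0) ->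
  exists y, {in A, forall i, dot y (v i) = f i}.
Proof.
move=> hf; pose F y i := if i \in A then sgn2 (f i + dot y (v i)) else 0.
have [y /forall_inP hy|noy] := pickP (fun y => [forall i in A, dot y (v i) == f i]).
  by exists y => i iA; apply/eqP/hy.
(* The factor is 2, 0 or 1 according to whether equation [i] holds, fails or is not imposed, so
   without a solution every product is 0. *)
have : \sum_y \prod_i (F y i + 1) = 0.
  apply: big1 => y _; have := noy y => /negbT; rewrite negb_forall_in => /exists_inP[i iA yi].
  rewrite (bigD1 i) //= /F iA; move: yi.
  by case: (F2_cases (f i)) => ->; case: (F2_cases (dot y (v i))) => -> //= _; rewrite mul0r.
under eq_bigr => y _ do rewrite bigA_distr.
rewrite exchange_big /= (bigD1 set0) //=.
have -> : \sum_y \prod_i (if i \in set0 then F y i else 1) = (2 ^ d)%:R.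
  rewrite (eq_bigr (fun=> 1)) ?sumr_const ?card_rV // => y _.
  by apply: big1 => i _; rewrite inE.
move=> eq0; suff : 0 <= \sum_(J in {set I} | J != set0)
    \sum_y \prod_i (if i \in J then F y i else 1).
  have lt0 : (0 : int) < (2 ^ d)%:R by rewrite ltr0n expn_gt0.
  by move=> ge0; have := ltr_wpDr ge0 lt0; rewrite eq0 ltxx.
apply: sumr_ge0 => J _; case: (boolP (J \subset A)) => [JA|/subsetPn[i iJ iA]]; last first.
  by rewrite big1 // => y _; rewrite (bigD1 i) //= iJ /F (negPf iA) mul0r.
have prodJ y : \prod_i (if i \in J then F y i else 1) =
    sgn2 (\sum_(i in J) f i) * chr y (\sum_(i in J) v i).
  rewrite -big_mkcond /= /chr -/(sgn2 _) dot_sumr -sgn2D -big_split /=.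
  rewrite (big_morph sgn2 sgn2D (erefl : sgn2 0 = 1)).
  by apply: eq_bigr => i iJ; rewrite /F (subsetP JA).
under eq_bigr => y _ do rewrite prodJ.
rewrite -big_distrr /= sum_chr; case: eqP => [/(hf _ JA) ->|_]; last by rewrite mulr0.
by rewrite mul1r ler0n.
Qed.

(** Affine dependencies are even zero-sum subsets; an odd [J] becomes even by removing or adding
    [e0], whose vector [e0 + e0] is 0. *)
Lemma solve_affine E e0 (f : 'rV['F_2]_d -> 'F_2) : e0 \in E ->
    (forall J : {set 'rV['F_2]_d}, J \subset E -> ~~ odd #|J| ->
       \sum_(x in J) x = 0 -> \sum_(x in J) f x = 0) ->
  exists y, {in E, forall e, dot y (e + e0) = f e + f e0}.
Proof.
move=> e0E hf; apply: (solve (v := fun e => e + e0) (f := fun e => f e + f e0)) => J JE.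
rewrite [X in X = 0 -> _]big_split [X in _ -> X = 0]big_split /= !sumr_const.
rewrite (mulrn_odd _ (addxx e0)) (mulrn_odd _ (F2_addxx (f e0))).
case: (boolP (odd #|J|)) => [oddJ|evJ]; last by rewrite !mulr0n !addr0; apply: hf.
rewrite !mulr1n; have [e0J|e0J] := boolP (e0 \in J).
  rewrite ![\sum_(i in J) _](big_setD1 e0 e0J) /= addrAC addxx add0r => J0.
  rewrite addrAC F2_addxx add0r hf //; first exact: subset_trans (subD1set _ _) JE.
  by move: oddJ; rewrite (cardsD1 e0 J) e0J.
rewrite ![\sum_(i in J) _ + _]addrC -(big_setU1 _ e0J) -[in X in _ -> X](big_setU1 _ e0J).
apply: hf.
  by rewrite subUset sub1set e0E.
by rewrite cardsU1 e0J /= oddJ.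
Qed.

Lemma dot_mulmx k (u : 'rV['F_2]_k) (Y : 'M['F_2]_(k, d)) x :
  dot (u *m Y) x = \sum_i u 0 i * dot (row i Y) x.
Proof.
rewrite /dot; under eq_bigr => j _ do rewrite mxE big_distrl /=.
rewrite exchange_big /=; apply: eq_bigr => i _; rewrite big_distrr /=.
by apply: eq_bigr => j _; rewrite mxE mulrA.
Qed.

(** The row space of [Y] serves: since [ft E 0] is |E|, no nonzero [u] has [u *m Y = 0]. *)
Lemma good_of_mx E k (Y : 'M['F_2]_(k, d)) : #|E| = (2 ^ k)%N ->
  (forall u : 'rV['F_2]_k, u != 0 -> ft E (u *m Y) = 0) -> good E.
Proof.
move=> cE Y0; have nzY (u : 'rV['F_2]_k) : u != 0 -> u *m Y != 0.
  move=> u0; have := Y0 u u0 => uY; apply/eqP => uY0; move: uY; rewrite uY0 ft0 cE => /eqP.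
  by rewrite pnatr_eq0 expn_eq0.
exists [set u *m Y | u : 'rV['F_2]_k]; split.
- split; first by apply/imsetP; exists 0; rewrite ?mul0mx.
  move=> _ _ /imsetP[u _ ->] /imsetP[v _ ->]; apply/imsetP.
  by exists (u + v); rewrite ?mulmxDl.
- rewrite card_imset ?card_rV ?cE // => u v uv; apply/eqP.
  rewrite -addx_eq0; apply: contraT => /nzY.
  by rewrite mulmxDl uv addxx eqxx.
- move=> _ /imsetP[u _ ->] uY; apply: Y0; apply: contraNneq uY => ->.
  by rewrite mul0mx.
Qed.

Lemma ft_translate E u e0 : ft E u = chr u e0 * \sum_(e in E) chr u (e + e0).
Proof.
rewrite big_distrr /=; apply: eq_bigr => e _.
by rewrite chrDr mulrCA chr_sq mulr1.
Qed.

(** Solving for each coordinate of [phi] gives an affine map equal to [phi] on [E]. On the row space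
    of its linear part, [ft E] is up to sign a character sum over all of Z_2^k. *)
Lemma good_of_bij E k (phi : 'rV['F_2]_d -> 'rV['F_2]_k) :
    #|E| = (2 ^ k)%N -> {in E &, injective phi} ->
    (forall J : {set 'rV['F_2]_d}, J \subset E -> ~~ odd #|J| ->
       \sum_(x in J) x = 0 -> \sum_(x in J) phi x = 0) ->
  good E.
Proof.
move=> cE inj hphi; have /card_gt0P[e0 e0E] : (0 < #|E|)%N by rewrite cE expn_gt0.
have imE : phi @: E = setT.
  by apply/eqP; rewrite eqEcard subsetT cardsT card_rV card_in_imset ?cE /=.
have hi (i : 'I_k) : exists y, {in E, forall e, dot y (e + e0) = phi e 0 i + phi e0 0 i}.
  apply: (solve_affine (f := fun e => phi e 0 i)) => // J JE evJ J0.
  by have := hphi J JE evJ J0 => /(congr1 (fun r : 'rV_k => r 0 i)); rewrite summxE mxE.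
have [y hy] := fin_all_exists hi.
apply: (@good_of_mx E k (\matrix_i y i)) => // u u0.
have dotu e : e \in E -> dot (u *m \matrix_i y i) (e + e0) = dot u (phi e + phi e0).
  move=> eE; rewrite dot_mulmx; apply: eq_bigr => i _.
  by rewrite rowK hy // mxE.
rewrite (ft_translate _ _ e0) (eq_bigr (fun e => chr u (phi e0) * chr u (phi e))); last first.
  by move=> e eE; rewrite /chr dotu // -!/(sgn2 _) dotDr sgn2D mulrC.
rewrite -big_distrr /= -(big_imset (chr u) inj) imE.
under eq_bigl do rewrite inE.
by under eq_bigr do rewrite chrC; rewrite sum_chr (negPf u0) !mulr0.
Qed.

End Tools.

(** A coordinate equals 1 on half of the 2^k vectors, an even number when k >= 2; for k = 1 the sum
    is 1. *)
Lemma sum_rV k : k != 1%N -> \sum_(v : 'rV['F_2]_k) v = 0.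
Proof.
move=> k1; apply/rowP => i; rewrite summxE mxE.
have := sum_chr (delta_mx 0 i : 'rV['F_2]_k).
have -> : (delta_mx 0 i == 0 :> 'rV['F_2]_k) = false.
  by apply/eqP => /rowP/(_ i); rewrite !mxE !eqxx => /eqP; rewrite oner_eq0.
have dotd v : dot v (delta_mx 0 i) = v 0 i.
  rewrite /dot (bigD1 i) //= big1 => [|j ji]; rewrite !mxE ?eqxx ?mulr1 ?addr0 //.
  by rewrite (negPf ji) andbF mulr0.
have chrd v : chr v (delta_mx 0 i) = 1 - ((v 0 i != 0) : nat)%:R *+ 2.
  by rewrite chrE dotd; case: eqP.
under eq_bigr => v _ do rewrite chrd.
rewrite big_split /= sumr_const card_rV sumrN sumrMnl -natr_sum.
have -> : \sum_(v : 'rV['F_2]_k) v 0 i = (\sum_(v : 'rV['F_2]_k) ((v 0 i != 0)%R : nat))%:R.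
  rewrite natr_sum; apply: eq_bigr => v _.
  by case: (F2_cases (v 0 i)) => ->.
move: (\sum_v _)%N => N /eqP.
have -> : (2 ^ k = 2 ^ k.-2 * 2 * 2)%N.
  have lt_ik := ltn_ord i; rewrite -!expnSr; congr (2 ^ _)%N; lia.
rewrite subr_eq0 -mulrnA eqr_nat eqn_pmul2r // => /eqP <-.
by rewrite natrM (_ : 2%:R = 0) ?mulr0 //; apply: val_inj.
Qed.

(** The bijection [phi] is arbitrary: the only nonempty dependency it must respect is [E] itself.
    For k = 1 there is none, as two distinct points do not sum to 0. *)
Lemma good_of_circuit d (E : {set 'rV['F_2]_d}) k : #|E| = (2 ^ k)%N ->
    (forall J : {set 'rV['F_2]_d}, J \subset E -> ~~ odd #|J| ->
       \sum_(x in J) x = 0 -> J = set0 \/ J = E) ->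
  good E.
Proof.
move=> cE hE; pose phi x : 'rV['F_2]_k := nth 0 (enum {: 'rV['F_2]_k}) (index x (enum E)).
have inj : {in E &, injective phi}.
  have lti x : x \in E -> (index x (enum E) < size (enum {: 'rV['F_2]_k}))%N.
    by move=> xE; rewrite -cardE card_rV -cE cardE index_mem mem_enum.
  move=> x y xE yE /eqP; rewrite nth_uniq ?enum_uniq ?lti // => /eqP.
  by apply: index_inj; rewrite ?mem_enum.
apply: (good_of_bij cE inj) => J JE evJ J0.
have [->|JEq] := hE J JE evJ J0; first by rewrite big_set0.
rewrite JEq -(big_imset id inj) /=.
have -> : phi @: E = setT.
  by apply/eqP; rewrite eqEcard subsetT cardsT card_rV card_in_imset ?cE /=.
under eq_bigl do rewrite inE.
have [k1|/sum_rV //] := eqVneq k 1%N.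
move: J0; rewrite JEq; have /eqP/cards2P[x [y [xy ->]]] : #|E| = 2%N by rewrite cE k1.
rewrite big_setU1 ?inE //= big_set1 => /eqP.
by rewrite addx_eq0 (negPf xy).
Qed.

(** * Tilings by at most eight points *)

(** Proves identities between sums of at most five vectors by trying all values of a coordinate;
    with fewer vectors, an argument is repeated. *)
Ltac char2 c0 c1 c2 c3 c4 :=
  apply/rowP; let r := fresh "r" in intro r; rewrite !mxE;
  move: (c0 0 r) (c1 0 r) (c2 0 r) (c3 0 r) (c4 0 r);
  do 5!case=> [[|[|//]] ?]; apply: val_inj.

Section EightPoints.

Variable d : nat.
Implicit Types (x y z : 'rV['F_2]_d) (E T U L C J : {set 'rV['F_2]_d}).

Lemma dotDr_eq0 y x z : (dot y (x + z) == 0) = (dot y x == dot y z).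
Proof.
rewrite dotDr; case: (F2_cases (dot y x)) => ->.
  by rewrite add0r eq_sym.
by case: (F2_cases (dot y z)) => ->.
Qed.

Lemma set_seqP n J : #|J| = n ->
  exists s : seq 'rV['F_2]_d, [/\ size s = n, uniq s, J =i s &
    \sum_(x in J) x = \sum_(x <- s) x].
Proof.
move=> <-; exists (enum J); rewrite -cardE enum_uniq big_enum; split=> // x.
by rewrite mem_enum.
Qed.

Lemma sum2_neq0 J : #|J| = 2%N -> \sum_(x in J) x != 0.
Proof.
move=> /eqP/cards2P[x [y [xy ->]]]; rewrite big_setU1 ?inE //= big_set1.
by rewrite addx_eq0.
Qed.

(* Five of the eight points of [T] lie in a 3-dimensional affine subspace. *)
Lemma good_of_zero4 E T J : direct E T -> (#|E| * #|T| = 2 ^ d)%N -> #|T| = 8%N ->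
  J \subset T -> #|J| = 4%N -> \sum_(x in J) x = 0 -> good E.
Proof.
move=> dET cET cT JT cJ J0; have [j0] : exists j0, j0 \in T :\: J.
  by apply/card_gt0P; rewrite cardsD (setIidPr JT) cT cJ.
rewrite inE => /andP[j0J j0T].
have [s [ss us Js sE]] := set_seqP cJ.
case: s ss us Js sE => [|i0 [|i1 [|i2 [|i3 [|]]]]] // _ us Js.
rewrite J0 !big_cons big_nil addr0 => /esym/eqP; rewrite addx_eq0 => /eqP i0E.
apply: (@good_concentrated d E T [:: i1 + i2; i1 + i3; i1 + j0] (j0 |: J) i1) => //.
- by rewrite cT.
- by rewrite subUset sub1set j0T.
- by rewrite cardsU1 j0J cJ cT.
move=> u; rewrite inE /= !dotDr_eq0 andbT => /and3P[/eqP u2 /eqP u3 /eqP uj] c.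
rewrite !inE Js !inE => /orP[/eqP->|/or4P[]/eqP->] //.
by rewrite i0E !dotDr -u2 -u3 F2_addxx addr0.
Qed.

(** Every nonzero combination of four vectors [c0 + ci] is a sum of two distinct points of [E]. The
    translates of [T] by the 16 combinations are therefore disjoint and have 128 elements, too many
    for V. *)
Lemma no_zero6 E T J : direct E T -> #|T| = 8%N -> (2 ^ d <= 64)%N ->
  J \subset E -> #|J| = 6%N -> \sum_(x in J) x <> 0.
Proof.
move=> dET cT d6 JE cJ J0.
have [s [ss us Js sE]] := set_seqP cJ.
case: s ss us Js sE => [|c0 [|c1 [|c2 [|c3 [|c4 [|c5 [|]]]]]]] // _ us Js.
rewrite J0 !big_cons big_nil addr0 => /esym sum0.
have c5E : c5 = c0 + c1 + c2 + c3 + c4.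
  by apply/eqP; rewrite eq_sym -addx_eq0 -!addrA sum0.
have inE' c : c \in [:: c0; c1; c2; c3; c4; c5] -> c \in E.
  by rewrite -Js; apply: subsetP.
pose X : 'M['F_2]_(4, d) := \matrix_i (c0 + nth 0 [:: c1; c2; c3; c4] i).
have pairX (w : 'rV['F_2]_4) : w != 0 -> exists x y, [/\ x \in E, y \in E, x != y & w *m X = x + y].
  move=> w0; pose s := [:: c0; c1; c2; c3; c4; c5].
  have fin i j : (i < 6)%N -> (j < 6)%N -> i != j -> w *m X = s`_i + s`_j ->
      exists x y, [/\ x \in E, y \in E, x != y & w *m X = x + y].
    by move=> i6 j6 ij eq; exists s`_i, s`_j; split; rewrite ?inE' ?mem_nth ?nth_uniq.
  have wX : w *m X = w 0 0 *: (c0 + c1) + (w 0 1 *: (c0 + c2) +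
      (w 0 2%:R *: (c0 + c3) + w 0 3%:R *: (c0 + c4))).
    rewrite mulmx_sum_row !big_ord_recl big_ord0 !rowK /= addr0.
    by do !congr (_ + _); congr (w 0 _ *: _); apply: val_inj.
  have w00 : ~ [/\ w 0 0 = 0, w 0 1 = 0, w 0 2%:R = 0 & w 0 3%:R = 0].
    case=> w_0 w_1 w_2 w_3; move: w0 => /eqP[]; apply/rowP => i; rewrite mxE.
    by case: i => [[|[|[|[|//]]]] lt_i];
      [rewrite -[RHS]w_0 | rewrite -[RHS]w_1 | rewrite -[RHS]w_2 | rewrite -[RHS]w_3];
      congr (w 0 _); apply: val_inj.
  (* For [w] of weight 3 or 4, [c5] turns a sum of four of the points into the sum of the other
     two. *)
  case: (F2_cases (w 0 0)) wX w00 => ->; case: (F2_cases (w 0 1)) => ->;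
  case: (F2_cases (w 0 2%:R)) => ->; case: (F2_cases (w 0 3%:R)) => ->;
  rewrite ?scale0r ?scale1r ?add0r ?addr0 => wX w00; rewrite ?wX in fin *.
  - by case: w00.
  - by apply: (fin 0%N 4%N) => //=; rewrite ?c5E; char2 c0 c1 c2 c3 c4.
  - by apply: (fin 0%N 3%N) => //=; rewrite ?c5E; char2 c0 c1 c2 c3 c4.
  - by apply: (fin 3%N 4%N) => //=; rewrite ?c5E; char2 c0 c1 c2 c3 c4.
  - by apply: (fin 0%N 2%N) => //=; rewrite ?c5E; char2 c0 c1 c2 c3 c4.
  - by apply: (fin 2%N 4%N) => //=; rewrite ?c5E; char2 c0 c1 c2 c3 c4.
  - by apply: (fin 2%N 3%N) => //=; rewrite ?c5E; char2 c0 c1 c2 c3 c4.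
  - by apply: (fin 1%N 5%N) => //=; rewrite ?c5E; char2 c0 c1 c2 c3 c4.
  - by apply: (fin 0%N 1%N) => //=; rewrite ?c5E; char2 c0 c1 c2 c3 c4.
  - by apply: (fin 1%N 4%N) => //=; rewrite ?c5E; char2 c0 c1 c2 c3 c4.
  - by apply: (fin 1%N 3%N) => //=; rewrite ?c5E; char2 c0 c1 c2 c3 c4.
  - by apply: (fin 2%N 5%N) => //=; rewrite ?c5E; char2 c0 c1 c2 c3 c4.
  - by apply: (fin 1%N 2%N) => //=; rewrite ?c5E; char2 c0 c1 c2 c3 c4.
  - by apply: (fin 3%N 5%N) => //=; rewrite ?c5E; char2 c0 c1 c2 c3 c4.
  - by apply: (fin 4%N 5%N) => //=; rewrite ?c5E; char2 c0 c1 c2 c3 c4.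
  - by apply: (fin 0%N 5%N) => //=; rewrite ?c5E; char2 c0 c1 c2 c3 c4.
have inj : {in setX T setT &, injective (fun p : 'rV['F_2]_d * 'rV['F_2]_4 => p.1 + p.2 *m X)}.
  move=> [t w] [t' w'] /setXP[tT _] /setXP[t'T _] /= eq.
  have [ww'|ww'] := eqVneq w w'; first by move: eq; rewrite ww' => /addIr ->.
  have [|x [y [xE yE xy ww'X]]] := pairX (w + w'); first by rewrite addx_eq0.
  have eqxy : x + t = y + t'.
    by apply/eqP; rewrite -addx_eq0 addrACA -ww'X mulmxDl addrC addrACA eq addxx.
  by have [/eqP] := dET x y xE yE t t' tT t'T eqxy; rewrite (negPf xy).
have := max_card (mem [set p.1 + p.2 *m X | p in setX T [set: 'rV['F_2]_4]]).
rewrite card_in_imset // cardsX cardsT cT !card_rV; move: d6.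
by move=> /[swap] /leq_trans/[apply].
Qed.

Lemma subspace_span2 a b : subspace [set x in [:: 0; a; b; a + b] : seq 'rV['F_2]_d].
Proof.
split=> [|x y]; rewrite !inE ?eqxx //.
have E1 : b + (a + b) = a by rewrite addrCA addxx addr0.
have E2 : a + b + a = b by rewrite addrAC addxx add0r.
move=> /or4P[]/eqP-> /or4P[]/eqP->;
  by rewrite ?add0r ?addr0 ?addxx ?addKx ?addxK ?E1 ?E2 ?(addrC b a) ?eqxx ?orbT.
Qed.

(** Translation by [p] preserves [E] and multiplies [ft E u] by -1. *)
Lemma ft_period E p u : {in E, forall e, e + p \in E} -> dot u p != 0 -> ft E u = 0.
Proof.
move=> Ep up; have : ft E u = \sum_(e in E) chr u (e + p).
  rewrite /ft (reindex_inj (addIr p)) /=; apply: eq_bigl => e.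
  by apply/idP/idP => [/Ep|/Ep//]; rewrite addxK.
under eq_bigr => e _ do rewrite chrDr.
rewrite -big_distrl /= (chrE u p) (negPf up) mulrN1 -/(ft E u); lia.
Qed.

(** The rows of [Z^T] are dual to the rows of [X], so a nonzero combination of them pairs
    nontrivially with some period. *)
Lemma good_of_periods E k (X : 'M['F_2]_(k, d)) : #|E| = (2 ^ k)%N ->
    (forall v : 'rV['F_2]_k, v *m X = 0 -> v = 0) ->
    (forall i, {in E, forall e, e + row i X \in E}) ->
  good E.
Proof.
move=> cE injX perE; have /row_freeP[Z XZ] : row_free X.
  by rewrite -kermx_eq0; apply/rowV0P => v /sub_kermxP/injX.
apply: (good_of_mx (Y := Z^T) cE) => u /eqP u0.
have [i ui|u_0] := pickP (fun i => u 0 i != 0); last first.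
  by case: u0; apply/rowP => i; rewrite mxE; apply/eqP; have := u_0 i => /negbFE.
apply: (ft_period (perE i)); suff -> : dot (u *m Z^T) (row i X) = u 0 i by [].
transitivity ((u *m (X *m Z)^T) 0 i); last by rewrite XZ trmx1 mulmx1.
rewrite trmx_mul mulmxA [RHS]mxE; apply: eq_bigr => j _.
by rewrite !mxE.
Qed.

(** [L] and its translate by [a] are disjoint and each fills half of the coset [c + U]. *)
Lemma half_flip U L c a : subspace U -> {in L, forall l, l + c \in U} ->
    #|U| = (2 * #|L|)%N -> a \in U -> {in L, forall l, l + a \notin L} ->
  forall x, x + c \in U -> (x + a \in L) = (x \notin L).
Proof.
move=> [U0 UD] LU cU aU La x xU; apply/idP/idP => [xaL|xL].
  by apply: contraL (La _ xaL) => xL; rewrite addxK negbK.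
have : x \in L :|: [set l + a | l in L].
  suff -> : L :|: [set l + a | l in L] = [set l + c | l in U].
    by apply/imsetP; exists (x + c); rewrite ?addxK.
  apply/eqP; rewrite eqEcard; apply/andP; split.
    apply/subsetP => y; rewrite inE => /orP[yL|/imsetP[l lL ->]]; apply/imsetP.
      by exists (y + c); rewrite ?addxK ?LU.
    exists (l + c + a); first by rewrite UD ?LU.
    by rewrite [l + c + a]addrAC addxK.
  rewrite cardsU !(card_imset _ (addIr _)) cU mul2n addnn.
  suff -> : L :&: [set l + a | l in L] = set0 by rewrite cards0 subn0.
  apply/setP => y; rewrite !inE; apply/negP => /andP[yL /imsetP[l lL yE]].
  by have := La _ lL; rewrite -yE yL.
by rewrite inE (negPf xL) => /imsetP[l lL ->]; rewrite addxK.
Qed.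

End EightPoints.

Lemma card_sum_set_seq d (s : seq 'rV['F_2]_d) : uniq s ->
  #|[set x in s]| = size s /\ \sum_(x in [set x in s]) x = \sum_(x <- s) x.
Proof.
move=> us; rewrite cardsE; split; first exact/card_uniqP.
by rewrite (big_uniq _ us) /=; apply: eq_bigl => x; rewrite inE.
Qed.

(** * Tiles in dimension at most six *)

Section TilesGood.

Variable d : nat.
Implicit Types (x y z : 'rV['F_2]_d) (E T U L C J S : {set 'rV['F_2]_d}).

Lemma good_of_zero4_self E T S : direct E T -> #|E| = 8%N -> #|T| = 8%N ->
  (2 ^ d = 64)%N -> S \subset E -> #|S| = 4%N -> \sum_(x in S) x = 0 -> good E.
Proof.
move=> dET cE cT d6 SE cS S0; have SE' := subsetP SE.
have [s [ss us Ss sE]] := set_seqP cS.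
case: s ss us Ss sE => [|s0 [|s1 [|s2 [|s3 [|]]]]] // _ us Ss.
rewrite S0 !big_cons big_nil addr0 => /esym sum0.
pose a := s0 + s1; pose b := s0 + s2; pose Q := [set x in [:: 0; a; b; a + b]].
have abE : a + b = s0 + s3.
  move/eqP: sum0; rewrite !addrA addx_eq0 /a /b => /eqP <-.
  by char2 s0 s1 s2 s1 s2.
have QS x : (x \in Q) = (s0 + x \in S).
  have eqs y : (s0 + x == y) = (x == s0 + y).
    by rewrite -[LHS]addx_eq0 -[RHS]addx_eq0 addrA (addrC x).
  by rewrite !inE Ss !inE !eqs addxx abE.
have [Q0 QD] : subspace Q := subspace_span2 a b.
have s0E : s0 \in E by rewrite SE' // Ss inE eqxx.
have imQ : S = [set s0 + x | x in Q].
  apply/setP => x; apply/idP/imsetP => [xS|[y yQ ->]]; last by rewrite -QS.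
  by exists (s0 + x); rewrite ?QS addKx.
have cQ : #|Q| = 4%N by rewrite -cS imQ (card_imset _ (addrI s0)).
have dQT : direct Q T.
  move=> q q' qQ q'Q t t' tT t'T eq.
  have [|||/addrI -> -> //] := dET (s0 + q) (s0 + q') _ _ t t' tT t'T.
  - by rewrite SE' // -QS.
  - by rewrite SE' // -QS.
  - by rewrite -!addrA eq.
(* Either two points outside [S] differ by an element off [Q], which yields four points of [T] of
   sum 0, or [E] is a union of two cosets of [Q]. *)
have [/exists_inP[s' s'N /exists_inP[s'' s''N pQ]]|allQ] :=
    boolP [exists s' in E :\: S, exists s'' in E :\: S, s' + s'' \notin Q].
  pose D := [set p.1 + p.2 | p in setX Q T].
  have cD : #|D| = 32%N by rewrite (card_in_imset (direct_inj dQT)) cardsX cQ cT.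
  have DP x : reflect (exists q t, [/\ q \in Q, t \in T & x = q + t]) (x \in D).
    apply: (iffP imsetP) => [[[q t] /setXP[qQ tT] ->]|[q [t [qQ tT ->]]]].
      by exists q, t.
    by exists (q, t); rewrite // inE qQ.
  (* [D = Q + T] is half of V, and it misses its translate by [s0 + r] because S + T and r + T are
     disjoint. Two such flips make [p] a period of [D]. *)
  have flip r x : r \in E :\: S -> (x + (s0 + r) \in D) = (x \notin D).
    rewrite inE => /andP[rS rE].
    suff Dr : {in D, forall l, l + (s0 + r) \notin D}.
      apply: (half_flip (c := 0) (@subspaceT d)) => // [l _||]; rewrite ?inE //.
      by rewrite cardsT card_rV cD d6.
    move=> l /DP[q [t [qQ tT lE]]]; apply/negP => /DP[q' [t' [q'Q t'T eq]]].
    have qq'S : s0 + (q + q') \in S by rewrite -QS QD.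
    have eq' : r + t = s0 + (q + q') + t'.
      apply/eqP; rewrite -addx_eq0; apply/eqP.
      have <- : (q + t + (s0 + r)) + (q' + t') = 0 by rewrite -lE eq addxx.
      rewrite -(addrA s0) -(addrA q q'); move: (q' + t') => w.
      by char2 q t s0 r w.
    have [rE' _] := dET r _ rE (SE' _ qq'S) t t' tT t'T eq'.
    by rewrite -rE' (negPf rS) in qq'S.
  pose p := s' + s''.
  have Dp x : x \in D -> x + p \in D.
    move=> xD; have -> : x + p = x + (s0 + s') + (s0 + s'').
      by rewrite -addrA (addrACA s0) addxx add0r.
    by rewrite !flip // negbK.
  (* Here [q] is nonzero: if [t + p] were in [T], then s' + t = s'' + (t + p) would contradict
     directness. *)
  have Tp t : t \in T -> exists q, [/\ q \in Q, q != 0 & t + p + q \in T].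
    move=> tT; have tD : t \in D by apply/DP; exists 0, t; rewrite add0r.
    have /DP[q [t' [qQ t'T eq]]] := Dp t tD.
    exists q; split=> //; last by rewrite eq addrAC addxx add0r.
    apply: contraNneq pQ => q0; rewrite q0 add0r in eq.
    have [[s'E _] [s''E _]] := (setDP s'N, setDP s''N).
    have [|-> _] := dET s' s'' s'E s''E t t' tT t'T; last by rewrite addxx Q0.
    by rewrite -eq /p addrCA (addrC s'') -addrA addxx addr0 addrC.
  pose Cq q := [set t in T | t + p + q \in T].
  (* Eight points of [T] share three nonzero values of [q], so some value serves at least three; one
     of these then lies outside {t1, t1 + r}. *)
  have [q qQ cq] : exists2 q, q \in Q & (2 < #|Cq q|)%N.
    have : (8 <= #|Cq a| + #|Cq b| + #|Cq (a + b)%R|)%N.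
      rewrite -cT; apply: leq_trans (leq_trans (leq_card_setU (Cq a :|: Cq b) (Cq (a + b))) _);
        last by rewrite leq_add2r leq_card_setU.
      apply/subset_leq_card/subsetP => t tT; have [q [qQ q0 tq]] := Tp t tT.
      move: qQ; rewrite !inE (negPf q0) /= tT /=.
      by move=> /or3P[]/eqP <-; rewrite tq ?orbT.
    have [ca _|ca] := ltnP 2 #|Cq a|; first by exists a; rewrite // !inE eqxx ?orbT.
    have [cb _|cb] := ltnP 2 #|Cq b|; first by exists b; rewrite // !inE eqxx ?orbT.
    by exists (a + b); [rewrite !inE eqxx ?orbT | lia].
  pose r := p + q; have r0 : r != 0.
    by apply: contraNneq pQ => /eqP; rewrite addx_eq0 /p => /eqP ->.
  have [t1 t1C] : exists t, t \in Cq q by apply/card_gt0P/(leq_trans _ cq).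
  have [t2] : exists t, t \in (Cq q :\ t1) :\ (t1 + r).
    apply/card_gt0P; move: cq; rewrite (cardsD1 t1) (cardsD1 (t1 + r) (Cq q :\ t1)).
    move: (t1 \in Cq q) (t1 + r \in _) #|_ :\ (t1 + r)| => b1 b2 n; clear.
    by case: b1; case: b2; case: n => [|[|]].
  rewrite !in_setD1 => /and3P[t21r t21]; rewrite inE -addrA -/r => /andP[t2T t2rT].
  move: t1C; rewrite inE -addrA -/r => /andP[t1T t1rT].
  have eqr x : (x == x + r) = false by rewrite -addx_eq0 addKx (negPf r0).
  have uJ : uniq [:: t1; t1 + r; t2; t2 + r].
    rewrite /= !inE !eqr /= !negb_or !andbT (eq_sym t1 t2) t21 (eq_sym _ t2) t21r.
    rewrite (inj_eq (addIr r)) (eq_sym t1 t2) t21 !andbT /=.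
    by rewrite -addx_eq0 addrCA addx_eq0 t21r.
  have [cJ sJ] := card_sum_set_seq uJ.
  apply: (@good_of_zero4 d E T [set x in [:: t1; t1 + r; t2; t2 + r]]) => //.
  - by rewrite cE cT d6.
  - by apply/subsetP => x; rewrite !inE => /or4P[]/eqP->.
  - by rewrite sJ !big_cons big_nil addr0 addKx addxK addxx.
have NQ : {in E :\: S &, forall x y, x + y \in Q}.
  move=> x y xN yN; apply: contraNT allQ => xyQ.
  by apply/exists_inP; exists x => //; apply/exists_inP; exists y.
have cN : #|E :\: S| = 4%N by rewrite cardsD (setIidPr SE) cE cS.
have [s' s'N] : exists s', s' \in E :\: S by apply/card_gt0P; rewrite cN.
have NE : E :\: S = [set s' + q | q in Q].
  apply/eqP; rewrite eqEcard (card_imset _ (addrI s')) cQ cN leqnn andbT.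
  by apply/subsetP => x xN; apply/imsetP; exists (s' + x); rewrite ?addKx // NQ.
have memE x : (x \in E) = (s0 + x \in Q) || (s' + x \in Q).
  rewrite QS addKx; have [xS|xS] := boolP (x \in S); first by rewrite SE'.
  have -> : (x \in E) = (x \in E :\: S) by rewrite inE xS.
  rewrite NE; apply/imsetP/idP => [[q qQ ->]|xQ]; first by rewrite addKx.
  by exists (s' + x); rewrite ?addKx.
(* Adding [c] exchanges the two cosets of [Q], so [a], [b], [c] are independent periods of [E]. *)
pose c := s0 + s'.
have cnQ : c \notin Q by rewrite QS addKx; move: s'N; rewrite inE => /andP[].
have aQ : a \in Q by rewrite !inE eqxx orbT.
have bQ : b \in Q by rewrite !inE eqxx !orbT.
have abQ := QD a b aQ bQ.
have [a0 b0 ab0] : [/\ a != 0, b != 0 & a + b != 0].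
  move: us; rewrite abE /= !addx_eq0 !inE !negb_or.
  by move=> /and3P[/and3P[-> -> ->]].
pose X : 'M['F_2]_(3, d) := \matrix_i nth 0 [:: a; b; c] i.
apply: (@good_of_periods d E 3 X) => //.
  move=> v; rewrite mulmx_sum_row !big_ord_recl big_ord0 !rowK /= addr0.
  set v0 := v 0 _; set v1 := v 0 _; set v2 := v 0 _ => eq.
  suff [v00 v10 v20] : [/\ v0 = 0, v1 = 0 & v2 = 0].
    apply/rowP => i; rewrite mxE.
    by case: i => [[|[|[|//]]] lt_i];
      [rewrite -[RHS]v00 | rewrite -[RHS]v10 | rewrite -[RHS]v20];
      congr (v 0 _); apply: val_inj.
  have nc x : x \in Q -> (x + c == 0) = false.
    by move=> xQ; rewrite addx_eq0; apply: contraNF cnQ => /eqP <-.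
  have nc0 : (c == 0) = false by rewrite -[c]add0r nc.
  move: eq; case: (F2_cases v0) => ->; case: (F2_cases v1) => ->; case: (F2_cases v2) => ->;
    rewrite ?scale0r ?scale1r ?add0r ?addr0 ?(addrA a b c) => /eqP //;
    by rewrite ?nc ?nc0 ?(negPf a0) ?(negPf b0) ?(negPf ab0).
move=> i e; rewrite rowK !memE; case: i => [[|[|[|//]]] lt_i] /=.
- by rewrite (addrA s0 e a) (addrA s' e a) => /orP[h|h]; rewrite (QD _ _ h aQ) ?orbT.
- by rewrite (addrA s0 e b) (addrA s' e b) => /orP[h|h]; rewrite (QD _ _ h bQ) ?orbT.
- rewrite /c (addrCA s0) addKx (addrCA s') (addrC s0 s') addKx.
  by rewrite (addrC e s') (addrC e s0) orbC.
Qed.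

Lemma good_of_card8 E T : direct E T -> #|E| = 8%N -> #|T| = 8%N ->
  (2 ^ d = 64)%N -> good E.
Proof.
move=> dET cE cT d6.
have [/existsP[S /and3P[SE /eqP cS /eqP S0]]|no4] :=
    boolP [exists S : {set 'rV['F_2]_d}, [&& S \subset E, #|S| == 4%N & \sum_(x in S) x == 0]].
  exact: (good_of_zero4_self dET cE cT d6 SE cS S0).
apply: (@good_of_circuit d E 3) => // J JE evJ J0.
have := subset_leq_card JE; rewrite cE.
move: evJ; case cJ: #|J| => [|[|[|[|[|[|[|[|[|]]]]]]]]] //= _ _.
- by left; apply/eqP; rewrite -cards_eq0 cJ.
- by have := sum2_neq0 cJ; rewrite J0 eqxx.
- by case/negP: no4; apply/existsP; exists J; rewrite JE cJ J0 !eqxx.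
- by case: (no_zero6 dET cT _ JE cJ J0); rewrite d6.
- by right; apply/eqP; rewrite eqEcard JE cE cJ.
Qed.

Lemma good_small E k : #|E| = (2 ^ k)%N -> (k <= 2)%N -> good E.
Proof.
move=> cE k2; apply: (good_of_circuit cE) => J JE evJ J0.
have := subset_leq_card JE; have : (#|E| <= 4)%N by rewrite cE (leq_pexp2l _ k2).
have [cJE _ _|cJE] := leqP #|E| #|J|; first by right; apply/eqP; rewrite eqEcard JE.
move=> cE4 _; have : (#|J| < 4)%N by apply: leq_trans cJE cE4.
move: evJ; case cJ: #|J| => [|[|[|[|]]]] //= _ _.
- by left; apply/eqP; rewrite -cards_eq0 cJ.
- by have := sum2_neq0 cJ; rewrite J0 eqxx.
Qed.

Lemma good_of_smallT E T k : direct E T -> (#|E| * #|T| = 2 ^ d)%N -> #|T| = (2 ^ k)%N ->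
  (k <= 2)%N -> good E.
Proof.
move=> dET cET cT; have := cT; case: k cT => [|[|[|//]]] _ cT _.
- have [s [ss us Ts _]] := set_seqP cT; case: s ss us Ts => [|t0 [|]] // _ _ Ts.
  apply: (good_concentrated (s := [::]) (C := T) (c0 := t0) dET cET); rewrite ?cT //.
  by move=> u _ c; rewrite Ts inE => /eqP->.
- have [s [ss us Ts _]] := set_seqP cT; case: s ss us Ts => [|t0 [|t1 [|]]] // _ _ Ts.
  apply: (good_concentrated (s := [:: t0 + t1]) (C := T) (c0 := t0) dET cET); rewrite ?cT //.
  move=> u; rewrite inE /= dotDr_eq0 andbT => /eqP ut c.
  by rewrite Ts !inE => /orP[]/eqP->.
- have [s [ss us Ts _]] := set_seqP cT.
  case: s ss us Ts => [|t0 [|t1 [|t2 [|t3 [|]]]]] // _ us Ts.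
  have uC : uniq [:: t0; t1; t2].
    move: us; rewrite /= !inE !negb_or !andbT.
    by case/and3P => /and3P[-> -> _] /andP[-> _] _.
  have [cC _] := card_sum_set_seq uC.
  apply: (good_concentrated (s := [:: t0 + t1; t0 + t2]) (C := [set x in [:: t0; t1; t2]])
            (c0 := t0) dET cET); rewrite ?cT ?cC //.
    by apply/subsetP => x; rewrite Ts !inE => /or3P[]->; rewrite ?orbT.
  move=> u; rewrite inE /= !dotDr_eq0 andbT => /andP[/eqP u1 /eqP u2] c.
  by rewrite !inE => /or3P[]/eqP->.
Qed.

Lemma tiles_good E : (d <= 6)%N -> tiles E -> good E.
Proof.
move=> d6 /tiles_direct[T dET cET].
have /(dvdn_pfactor _ _ (isT : prime 2))[k kd cE] : (#|E| %| 2 ^ d)%N.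
  by rewrite -cET dvdn_mulr.
have cT : #|T| = (2 ^ (d - k))%N.
  apply/eqP; rewrite -(@eqn_pmul2l (2 ^ k)) ?expn_gt0 // -cE cET cE -expnD.
  by rewrite subnKC.
have [k2|k3] := leqP k 2; first exact: good_small cE k2.
have [dk2|dk3] := leqP (d - k) 2; first exact: good_of_smallT dET cET cT dk2.
have [d6' k3'] : d = 6%N /\ k = 3%N by lia.
by apply: (good_of_card8 dET); rewrite ?cE ?cT ?d6' ?k3'.
Qed.

End TilesGood.

(** * Spectral sets *)

Section SpectralGood.

Variable d : nat.
Implicit Types (a b c l x y z : 'rV['F_2]_d) (E L S T U J : {set 'rV['F_2]_d}).

Lemma chr1E l x : chr l x + 1 = 2 * (dot l x == 0)%:R.
Proof. by rewrite chrE; case: ifP. Qed.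

(** The left side sums (1 + chr a)(1 + chr b) over [E], and each factor is 0 or 2; [ft_mod8] has
    three such factors. *)
Lemma ft_mod4 E a b : exists m, #|E|%:R + ft E a + ft E b + ft E (a + b) = 4 * m.
Proof.
exists (\sum_(x in E) (dot a x == 0)%:R * (dot b x == 0)%:R).
rewrite big_distrr -sumr_const /ft -!big_split /=; apply: eq_bigr => x _.
transitivity ((chr a x + 1) * (chr b x + 1)); last by rewrite !chr1E; ring.
by rewrite chrDl; ring.
Qed.

Lemma ft_mod8 E a b c : exists m,
  #|E|%:R + ft E a + ft E b + ft E c + ft E (a + b) + ft E (a + c) + ft E (b + c)
    + ft E (a + b + c) = 8 * m.
Proof.
exists (\sum_(x in E) (dot a x == 0)%:R * (dot b x == 0)%:R * (dot c x == 0)%:R).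
rewrite big_distrr -sumr_const /ft -!big_split /=; apply: eq_bigr => x _.
transitivity ((chr a x + 1) * (chr b x + 1) * (chr c x + 1)); last by rewrite !chr1E; ring.
by rewrite !chrDl; ring.
Qed.

Lemma norm_ft E a : `|ft E a| <= #|E|%:R.
Proof.
apply: le_trans (ler_norm_sum _ _ _) _.
by rewrite (eq_bigr (fun=> 1)) ?sumr_const // => x _; rewrite norm_chr.
Qed.

(** Equality case of the triangle inequality. *)
Lemma ft_extremal E a : `|ft E a| = #|E|%:R ->
  exists s : int, s * s = 1 /\ {in E, forall x, chr a x = s}.
Proof.
move=> nE; have [s [ss sE]] : exists s : int, s * s = 1 /\ s * ft E a = #|E|%:R.
  by move: nE; case: (ger0P (ft E a)) => _ <-; [exists 1 | exists (-1)]; split;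
    rewrite ?mulrNN ?mul1r ?mulN1r.
exists s; split=> // x xE.
have le y : s * chr a y <= 1.
  by apply: le_trans (ler_norm _) _; rewrite normrM norm_chr mulr1; lia.
have sum0 : \sum_(y in E) (1 - s * chr a y) = 0.
  by rewrite sumrB sumr_const -big_distrr /= -/(ft E a) sE subrr.
have ge0 y : y \in E -> 0 <= 1 - s * chr a y by rewrite subr_ge0.
have /eqP := psumr_eq0P ge0 sum0 xE; rewrite subr_eq0 => /eqP s1.
by rewrite -[LHS]mul1r -ss -mulrA -s1 mulr1.
Qed.

(** A square matrix with orthogonal rows has orthogonal columns: the squared entries of both Gram
    matrices have the same total |E|^3, which the diagonal of the second already exhausts. *)
Lemma spectrum_dual E L : spectrum E L ->
  {in E &, forall e e', e != e' -> ft L (e + e') = 0}.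
Proof.
move=> [cL orth].
pose sq e e' := ft L (e + e') ^+ 2.
have sqE e e' : sq e e' = \sum_(l in L) \sum_(l' in L) chr (l + l') e * chr (l + l') e'.
  rewrite /sq expr2 /ft big_distrlr /=; apply: eq_bigr => l _; apply: eq_bigr => l' _.
  by rewrite !chrDl !(chrC _ e) !(chrC _ e'); ring.
have total : \sum_(e in E) \sum_(e' in E) sq e e' = \sum_(e in E) #|E|%:R ^+ 2.
  transitivity (\sum_(l in L) \sum_(l' in L) ft E (l + l') ^+ 2).
    under eq_bigr => e _ do under eq_bigr => e' _ do rewrite sqE.
    under [RHS]eq_bigr => l _ do under eq_bigr => l' _ do rewrite expr2 /ft big_distrlr /=.
    under eq_bigr => e _ do rewrite exchange_big /=.
    rewrite exchange_big /=; apply: eq_bigr => l _.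
    under eq_bigr => e _ do rewrite exchange_big /=.
    by rewrite exchange_big.
  rewrite sumr_const -cL -sumr_const; apply: eq_bigr => l lL.
  rewrite (bigD1 l) //= big1 ?addr0 ?addxx ?ft0 ?cL // => l' /andP[l'L l'l].
  by rewrite orth ?expr0n // eq_sym.
have off : \sum_(e in E) \sum_(e' in E | e' != e) sq e e' = 0.
  move: total; under eq_bigr => e eE do rewrite (bigD1 e) //=.
  rewrite big_split /= (eq_bigr (fun=> #|E|%:R ^+ 2)) => [|e _]; last first.
    by rewrite /sq addxx ft0 cL.
  by move/(canRL (addKr _)) ->; rewrite addNr.
have off_e e : e \in E -> \sum_(e' in E | e' != e) sq e e' = 0.
  by move=> eE; apply: (psumr_eq0P _ off) => // e1 _; apply: sumr_ge0 => e2 _; apply: sqr_ge0.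
move=> e e' eE e'E ee'; apply/eqP; rewrite -sqrf_eq0; apply/eqP.
apply: (psumr_eq0P _ (off_e e eE)) => [e1 _|]; first exact: sqr_ge0.
by rewrite e'E eq_sym.
Qed.

(** In [ft_conv] at [a] the terms 0 and [a] give 2|E| [ft E a]; alone they would have to equal 2^d
    [ft E a]. *)
Lemma ft_line E a : (2 * #|E| != 2 ^ d)%N -> a != 0 -> ft E a != 0 ->
  exists b, [/\ b != 0, a + b != 0, ft E b != 0 & ft E (a + b) != 0].
Proof.
move=> cE a0 fa; have [b /and4P[b0 ab fb fab]|none] :=
  pickP (fun b => [&& b != 0, a + b != 0, ft E b != 0 & ft E (a + b) != 0]).
  by exists b.
have := ft_conv E a; rewrite (bigD1 0) //= (bigD1 a) //= add0r ft0 addxx ft0 big1.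
  rewrite addr0 (mulrC (ft E a)) -mulrDl => /(mulIf fa) /eqP.
  by rewrite -natrD eqr_nat addnn -mul2n (negPf cE).
move=> b /andP[b0 ba]; have := none b; rewrite b0 addx_eq0 eq_sym ba /= addrC.
by move/negbT; rewrite negb_and !negbK => /orP[]/eqP ->; rewrite ?mul0r ?mulr0.
Qed.

(** Two points of [L] in one coset of the plane would differ by [a], [b] or [a + b], where [ft E]
    does not vanish. *)
Lemma line_direct E L a b : spectrum E L ->
    [/\ a != 0, ft E a != 0, b != 0 & a + b != 0] -> ft E b != 0 -> ft E (a + b) != 0 ->
  direct L [set x in [:: 0; a; b; a + b]] /\ #|[set x in [:: 0; a; b; a + b]]| = 4%N.
Proof.
move=> [_ orth] [a0 fa b0 ab0] fb fab; split; last first.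
  have [|-> //] := @card_sum_set_seq d [:: 0; a; b; a + b].
  rewrite /= !inE !negb_or !(eq_sym 0) a0 b0 ab0 /= -addx_eq0 ab0.
  by rewrite -(addx_eq0 a) -(addx_eq0 b) addKx b0 addrCA addxx addr0 a0.
move=> l l' lL l'L s s' sS s'S eq.
have [_ SD] := subspace_span2 a b.
have ll' : l + l' = s + s'.
  by apply/eqP; rewrite -addx_eq0 addrACA eq addxx.
have [ll|ll] := eqVneq l l'; first by move: eq; rewrite ll => /addrI.
have f0 := orth l l' lL l'L ll.
have := SD s s' sS s'S; rewrite -ll' !inE addx_eq0 (negPf ll) /=.
by case/or3P => /eqP lE; move: f0; rewrite lE => /eqP; rewrite ?(negPf fa) ?(negPf fb) ?(negPf fab).
Qed.

Lemma odd_sums_nz L U c (s : seq 'rV['F_2]_d) l : subspace U ->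
    {in L, forall l, l + c \in U} -> #|U| = (2 * #|L|)%N ->
    {in s, forall a, a \in U /\ {in L, forall l, l + a \notin L}} -> l \in L ->
  (l + \sum_(a <- s) a \in L) = ~~ odd (size s) /\ l + \sum_(a <- s) a + c \in U.
Proof.
move=> sU LU cU; elim: s => [|a s IHs] sL lL; first by rewrite big_nil addr0 lL LU.
have [|IH1 IH2] := IHs _ lL; first by move=> b bs; apply: sL; rewrite inE bs orbT.
have [aU La] := sL a (mem_head _ _).
rewrite big_cons (addrC a) addrA; split.
  by rewrite (half_flip sU LU cU aU La) // IH1.
by rewrite [_ + a + c]addrAC; apply: (sU.2 _ _ IH2 aU).
Qed.

(** Adding a point of the support [A] toggles membership in [L] within [c + U], so zero-sum subsets
    of [A] are even and [solve] yields [y] with [dot y a = 1] on [A]. The part of [U] orthogonal to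
    [y] avoids [A]. *)
Lemma good_of_half E L U c : spectrum E L -> subspace U ->
  {in L, forall l, l + c \in U} -> #|U| = (2 * #|L|)%N -> good E.
Proof.
move=> [cL orth] sU LU cU.
have [L0|[l0 l0L]] := set_0Vmem L.
  by exists U; rewrite -cL L0 cards0; split=> // u uU _; rewrite /ft big_pred0 // => x;
     move/eqP: cL; rewrite L0 cards0 eq_sym cards_eq0 => /eqP ->; rewrite inE.
pose A := [set a in U | (a != 0) && (ft E a != 0)].
have AL a : a \in A -> a \in U /\ {in L, forall l, l + a \notin L}.
  rewrite inE => /and3P[aU a0 fa]; split=> // l lL; apply: contra fa => laL.
  by rewrite -(addKx l a) orth // -addx_eq0 addKx.
have [J JA J0|y yA] := @solve d _ A id (fun=> 1).
  have [s [ss us Js sE]] := set_seqP (erefl #|J|).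
  have [||+ _] := @odd_sums_nz L U c s l0 sU LU cU.
  - by move=> a; rewrite -Js => /(subsetP JA)/AL.
  - by [].
  rewrite -sE J0 addr0 l0L ss sumr_const mulrn_odd ?F2_addxx //.
  by case: (odd _).
exists [set u in U | dot u y == 0]; have [sW cW] := subspace_halve y sU.
split=> //; first by rewrite -cL -(leq_pmul2l (isT : 0 < 2)%N) -cU.
move=> u; rewrite inE => /andP[uU /eqP uy] u0; apply/eqP; apply: contraT => fu.
by have := yA u; rewrite inE uU u0 fu dotC uy => /(_ isT).
Qed.

(** In [ft_mod8] for the differences from [l0], six of the seven transforms are taken at differences
    of spectrum points and vanish. *)
Lemma ft_four E L l0 l1 l2 l3 : spectrum E L -> {subset [:: l0; l1; l2; l3] <= L} ->
    uniq [:: l0; l1; l2; l3] ->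
  exists m, #|E|%:R + ft E (l0 + l1 + l2 + l3) = 8 * m.
Proof.
move=> [_ orth] sL us; have [m mE] := ft_mod8 E (l0 + l1) (l0 + l2) (l0 + l3).
exists m; rewrite -mE.
have cancel x y z : x + y + (x + z) = y + z by rewrite addrACA addxx add0r.
rewrite !cancel.
have [L0 L1 L2 L3] : [/\ l0 \in L, l1 \in L, l2 \in L & l3 \in L].
  by rewrite !sL // !inE eqxx ?orbT.
move: us; rewrite /= !inE !negb_or => /and4P[/and3P[n01 n02 n03] /andP[n12 n13] n23 _].
rewrite (orth l0 l1) // (orth l0 l2) // (orth l0 l3) // (orth l1 l2) // (orth l1 l3) //.
rewrite (orth l2 l3) // !addr0.
by congr (_ + ft E _); char2 l0 l1 l2 l3 l0.
Qed.

Lemma good_spectrum8 E L : spectrum E L -> #|E| = 8%N -> good E.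
Proof.
move=> sEL cE; have [cL orth] := sEL; rewrite cE in cL.
have [s [ss us Ls _]] := set_seqP cL.
case: s ss us Ls => [|l0 [|l1 [|l2 [|l3 [|l4 [|l5 [|l6 [|l7 [|]]]]]]]]] // _ us Ls.
have uniqS (t : seq 'rV['F_2]_d) : subseq t [:: l0; l1; l2; l3; l4; l5; l6; l7] ->
    uniq t /\ {subset t <= L}.
  by move=> st; split; [exact: subseq_uniq st us | move=> x /(mem_subseq st); rewrite Ls].
have [u3 L3] : uniq [:: l0; l1; l2; l3] /\ {subset [:: l0; l1; l2; l3] <= L}.
  by apply: uniqS; rewrite /= !eqxx.
have [u4 L4] : uniq [:: l0; l1; l2; l4] /\ {subset [:: l0; l1; l2; l4] <= L}.
  apply: uniqS; apply: (@subseq_trans _ [:: l0; l1; l2; l3; l4]); last by rewrite /= !eqxx.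
  by rewrite /= !eqxx; case: (l4 == l3); rewrite /= ?eqxx.
(* A nonzero value is 8 or -8, so its character is constant on [E]. If both [l3] and [l4] gave this,
   the character of [l3 + l4] would be constant too, against orthogonality. *)
have [l3' [u' L' f0]] : exists l, [/\ uniq [:: l0; l1; l2; l],
    {subset [:: l0; l1; l2; l] <= L} & ft E (l0 + l1 + l2 + l) = 0].
  have [f3|f3] := eqVneq (ft E (l0 + l1 + l2 + l3)) 0; first by exists l3.
  have [f4|f4] := eqVneq (ft E (l0 + l1 + l2 + l4)) 0; first by exists l4.
  have ext q m : #|E|%:R + ft E q = 8 * m -> ft E q != 0 -> `|ft E q| = #|E|%:R.
    by move: (norm_ft E q); rewrite cE; lia.
  have [m3 /ext/(_ f3)/ft_extremal[s3 [ss3 h3]]] := ft_four sEL L3 u3.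
  have [m4 /ext/(_ f4)/ft_extremal[s4 [ss4 h4]]] := ft_four sEL L4 u4.
  have : ft E (l3 + l4) = 0.
    apply: orth; rewrite ?Ls ?inE ?eqxx ?orbT //.
    by move: us; rewrite /= !inE !negb_or => /and5P[_ _ _ /andP[]].
  have -> : l3 + l4 = (l0 + l1 + l2 + l3) + (l0 + l1 + l2 + l4).
    by char2 l0 l1 l2 l3 l4.
  rewrite /ft (eq_bigr (fun=> s3 * s4)) => [|x xE]; last by rewrite chrDl h3 ?h4.
  rewrite sumr_const cE => /eqP; rewrite mulrn_eq0 /= mulf_eq0 => /orP[]/eqP s0.
    by rewrite s0 in ss3.
  by rewrite s0 in ss4.
(* The nonzero combinations of the rows are six pairwise differences and the sum of all four
   points. *)
pose Y : 'M['F_2]_(3, d) := \matrix_i (l0 + nth 0 [:: l1; l2; l3'] i).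
have [L0 L1 L2 L3'] : [/\ l0 \in L, l1 \in L, l2 \in L & l3' \in L].
  by rewrite !L' // !inE eqxx ?orbT.
move: u'; rewrite /= !inE !negb_or => /and4P[/and3P[n01 n02 n03] /andP[n12 n13] n23 _].
have cancel x y z : x + y + (x + z) = y + z by rewrite addrACA addxx add0r.
apply: (good_of_mx (k := 3) (Y := Y)) => // v v0.
rewrite mulmx_sum_row !big_ord_recl big_ord0 !rowK /= addr0.
have : ~ [/\ v 0 ord0 = 0, v 0 (lift ord0 ord0) = 0 & v 0 (lift ord0 (lift ord0 ord0)) = 0].
  case=> w0 w1 w2; move/eqP: v0 => []; apply/rowP => i; rewrite mxE.
  by case: i => [[|[|[|//]]] lt_i];
    [rewrite -[RHS]w0 | rewrite -[RHS]w1 | rewrite -[RHS]w2];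
    congr (v 0 _); apply: val_inj.
case: (F2_cases (v 0 ord0)) => ->; case: (F2_cases (v 0 (lift ord0 ord0))) => ->;
  case: (F2_cases (v 0 (lift ord0 (lift ord0 ord0)))) => -> nz;
  rewrite ?scale0r ?scale1r ?add0r ?addr0 ?cancel;
  rewrite ?(orth l0 l1) ?(orth l0 l2) ?(orth l0 l3') ?(orth l1 l2) ?(orth l1 l3') ?(orth l2 l3') //.
- by case: nz.
- by rewrite -[RHS]f0; congr (ft E _); char2 l0 l1 l2 l3' l0.
Qed.

(** The 66 pairs in [L] would have distinct sums among at most 63 nonzero vectors. If two disjoint
    pairs had equal sums, three of their points and a further [l] would give 8 | 12 by [ft_four]. *)
Lemma no_spectrum12 E L : spectrum E L -> #|E| = 12%N -> (2 ^ d <= 64)%N -> False.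
Proof.
move=> sEL cE d6; have [cL orth] := sEL; rewrite cE in cL.
pose P := [set A : {set 'rV['F_2]_d} | (A \subset L) && (#|A| == 2)%N].
have cP : #|P| = 66%N by rewrite cards_draws cL.
have injP : {in P &, injective (fun A : {set 'rV['F_2]_d} => \sum_(x in A) x)}.
  move=> A B; rewrite !inE => /andP[AL /cards2P[x [y [xy AE]]]] /andP[BL /cards2P[z [w [zw BE]]]].
  subst A B; rewrite !big_setU1 ?inE //= !big_set1 => eq.
  have [xL yL] : x \in L /\ y \in L.
    by split; apply: (subsetP AL); rewrite !inE eqxx ?orbT.
  have [zL wL] : z \in L /\ w \in L.
    by split; apply: (subsetP BL); rewrite !inE eqxx ?orbT.
  have [xz|xz] := eqVneq x z; first by move: eq; rewrite xz => /addrI ->.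
  have [xw|xw] := eqVneq x w; first by move: eq; rewrite xw addrC => /addIr ->; rewrite setUC.
  have [yz|yz] := eqVneq y z; first by move: eq; rewrite yz addrC => /addrI ->; rewrite setUC.
  have [yw|yw] := eqVneq y w; first by move: eq; rewrite yw => /addIr ->.
  have [l lN] : exists l, l \in L :\: [set t in [:: x; y; z; w]].
    apply/card_gt0P; rewrite cardsD subn_gt0 cL.
    apply: leq_ltn_trans (subset_leq_card (subsetIr _ _)) _.
    rewrite (card_sum_set_seq _).1 //.
    by rewrite /= !inE !negb_or xy xz xw yz yw zw.
  move: lN; rewrite !inE !negb_or => /andP[/and4P[lx ly lz lw] lL].
  have [||m] := @ft_four E L x y z l sEL.
  - by move=> u; rewrite !inE => /or4P[]/eqP->.
  - by rewrite /= !inE !negb_or xy xz yz !(eq_sym _ l) lx ly lz.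
  rewrite eq [z + w + z]addrAC addxx add0r (orth w l) // 1?eq_sym // cE addr0.
  by clear; lia.
have : (#|P| <= #|[set: 'rV['F_2]_d] :\ 0%R|)%N.
  rewrite -(card_in_imset injP); apply/subset_leq_card/subsetP => _ /imsetP[A AP ->].
  rewrite !inE andbT; move: AP; rewrite inE => /andP[_ /eqP cA].
  exact: sum2_neq0.
have := cardsD1 (0 : 'rV['F_2]_d) setT; rewrite in_setT cardsT card_rV => card_setD1.
move: d6; rewrite cP card_setD1; move: #|_ :\ _| => N; clear; lia.
Qed.

(** Poisson summation for the whole space gives |U| |ann U| = |V|. *)
Lemma ann_neq0 U : subspace U -> U != setT -> exists2 x, x != 0 & x \in ann U.
Proof.
move=> sU UT; have [x /andP[x0 xU]|none] := pickP (fun x => (x != 0) && (x \in ann U)).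
  by exists x.
have ftT u : u != 0 -> ft setT u = 0.
  move=> u0; rewrite /ft; under eq_bigl do rewrite inE.
  by under eq_bigr do rewrite chrC; rewrite sum_chr (negPf u0).
have := sum_ft_subspace setT 0 sU; rewrite (bigD1 0) ?sU.1 //= big1 => [|u /andP[_ u0]]; last first.
  by rewrite ftT ?mul0r.
have -> : [set e in setT | e + 0 \in ann U] = [set 0].
  apply/setP => z; rewrite [LHS]in_set in_setT addr0 in_set1 /=; have := none z.
  case: eqP => [-> _|_ /= ->] //.
  by apply/annP => u _; rewrite dotC dot0l.
rewrite ft0 chr0l mulr1 addr0 cards1 muln1 => /eqP; rewrite eqr_nat => /eqP cU.
by case/negP: UT; rewrite eqEcard subsetT cU leqnn.
Qed.

Lemma card_hyper x : x != 0 -> (2 ^ d = 2 * #|ker [:: x]|)%N.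
Proof.
move=> x0; apply/eqP; rewrite -(eqr_nat int); apply/eqP.
have : \sum_u (chr u x + 1) = 2 * #|ker [:: x]|%:R.
  under eq_bigr => u _ do rewrite chr1E.
  rewrite -big_distrr /= -natr_sum; congr (_ * _%:R).
  rewrite -sum1_card [RHS]big_mkcond; apply: eq_bigr => u _.
  by rewrite inE /= andbT; case: (dot u x == 0).
by rewrite big_split /= sum_chr (negPf x0) add0r sumr_const card_rV natrM.
Qed.

Lemma sumsq_ft E : \sum_m ft E m ^+ 2 = (2 ^ d * #|E|)%:R.
Proof.
have := ft_corr E 0; under eq_bigr do rewrite chr0r mulr1.
move=> ->; congr (_ * _)%:R; apply: eq_card => e.
by rewrite inE addr0 andbb.
Qed.

Lemma good_spectrum16 E L : spectrum E L -> #|E| = 16%N -> (2 ^ d = 64)%N -> good E.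
Proof.
move=> sEL cE d6; have [cL orth] := sEL; rewrite cE in cL.
have [l0 l0L] : exists l, l \in L by apply/card_gt0P; rewrite cL.
have dual := spectrum_dual sEL.
have ft16 l l' : l \in L -> l' \in L -> (8 %| ft E (l + l'))%Z.
  move=> lL l'L; have [->|ll'] := eqVneq l l'; last by rewrite orth.
  by rewrite addxx ft0 cE.
(* The stabiliser [St] of [S] contains all [l0 + l] by [ft_mod8]. If [St] is proper, [L] lies in a
   translate of a hyperplane; otherwise 8 divides [ft E] everywhere, since 0 is in [S]. *)
pose S := [set m | (8 %| ft E m)%Z && [forall l in L, (8 %| ft E (m + (l0 + l)))%Z]].
pose St := [set g | [forall m in S, m + g \in S]].
have S0 : 0 \in S.
  rewrite inE ft0 cE /=; apply/forall_inP => l lL; by rewrite add0r ft16.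
have sSt : subspace St.
  split; first by rewrite inE; apply/forall_inP => m mS; rewrite addr0.
  move=> g h; rewrite !inE => /forall_inP gS /forall_inP hS.
  by apply/forall_inP => m mS; rewrite addrA hS ?gS.
have LSt l : l \in L -> l0 + l \in St.
  move=> lL; rewrite inE; apply/forall_inP => m; rewrite !inE => /andP[m8 /forall_inP mL].
  rewrite mL //=; apply/forall_inP => l' l'L.
  have [q] := ft_mod8 E m (l0 + l) (l0 + l').
  have -> : l0 + l + (l0 + l') = l + l' by rewrite addrACA addxx add0r.
  have /dvdzP[q1 ->] := m8; have /dvdzP[q2 ->] := mL l lL; have /dvdzP[q3 ->] := mL l' l'L.
  have /dvdzP[q4 ->] := ft16 l0 l l0L lL; have /dvdzP[q5 ->] := ft16 l0 l' l0L l'L.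
  have /dvdzP[q6 ->] := ft16 l l' lL l'L; rewrite cE => eq; apply/dvdzP.
  exists (q - 2 - q1 - q2 - q3 - q4 - q5 - q6); move: eq; clear.
  by move: (ft E _) => f; lia.
have [StT|/(ann_neq0 sSt)[x x0 /annP xSt]] := eqVneq St setT; last first.
  apply: (good_of_half (U := ker [:: x]) (c := l0) sEL (subspace_ker _)).
    by move=> l lL; rewrite inE /= andbT addrC xSt ?LSt.
  apply/eqP; rewrite -(eqn_pmul2l (isT : 0 < 2)%N) -card_hyper // cL.
  by rewrite d6.
have div8 m : (8 %| ft E m)%Z.
  have : m \in St by rewrite StT inE.
  by rewrite inE => /forall_inP/(_ 0 S0); rewrite add0r inE => /andP[].
(* If [ft L] vanished off 0, Parseval would give 16^2 = 64 * 16. *)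
have [x /andP[x0 fLx]|none] := pickP (fun x => (x != 0) && (ft L x != 0)); last first.
  have := sumsq_ft L; rewrite (bigD1 0) //= big1 => [|m m0].
    by rewrite ft0 cL d6.
  by have := none m; rewrite m0 /= => /negbFE/eqP->; rewrite expr0n.
(* By duality no two points of [E] differ by [x]. *)
have xE : #|[set e in E | e + x \in E]| = 0%N.
  apply/eqP; rewrite cards_eq0; apply/eqP/setP => e; rewrite !inE.
  apply/negP => /andP[eE exE]; case/eqP: fLx; rewrite -(addKx e x) dual //.
  by rewrite -addx_eq0 addKx.
pose A := [set m in ker [:: x] | (m != 0) && (ft E m != 0)].
(* Of a total of 1024, the term at 0 takes 512 and each [m] in [A] at least 8^2 * 2 = 128. *)
have cA : (#|A| <= 4)%N.
  have eq : \sum_m ft E m ^+ 2 * (chr m x + 1) = 1024.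
    under eq_bigr do rewrite mulrDr mulr1.
    by rewrite big_split /= sumsq_ft ft_corr xE muln0 cE d6.
  have le m : m \in A -> 128 <= ft E m ^+ 2 * (chr m x + 1).
    rewrite !inE /= andbT => /and3P[/eqP mx _ fm]; rewrite chr1E mx /=.
    by have /dvdzP[q qE] := div8 m; move: fm; rewrite qE; clear; nia.
  have ge0 m : 0 <= ft E m ^+ 2 * (chr m x + 1).
    by apply: mulr_ge0; rewrite ?sqr_ge0 // chrE; case: ifP.
  move: eq; rewrite (bigD1 0) //= ft0 cE chr0l (bigID (mem A)) /= => eq.
  have le1 : 128 * #|A|%:R <= \sum_(m | (m != 0) && (m \in A)) ft E m ^+ 2 * (chr m x + 1).
    rewrite mulr_natr -sumr_const [leRHS](eq_bigl (mem A)).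
      by apply: ler_sum => m /le.
    by move=> m /=; rewrite inE; case: (m == 0); rewrite ?andbF.
  have le2 : 0 <= \sum_(m | (m != 0) && (m \notin A)) ft E m ^+ 2 * (chr m x + 1).
    by apply: sumr_ge0 => m _; apply: ge0.
  have := lerD le1 le2; rewrite addr0 -(lerD2l (16%:R ^+ 2 * (1 + 1))) eq.
  by move: #|A|; clear => N; rewrite expr2; lia.
have [J JA J0|y yA] := @solve d _ A id (fun=> 1).
  rewrite sumr_const mulrn_odd ?F2_addxx //; case: (boolP (odd _)) => // oddJ.
  have := leq_trans (subset_leq_card JA) cA; move: oddJ.
  case cJ: #|J| => [|[|[|[|[|]]]]] //= _ _.
    have /eqP/cards1P[j JE] := cJ; move: J0 JA; rewrite JE big_set1 => ->.
    by rewrite sub1set !inE eqxx andbF.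
  have [s [ss us Js sE]] := set_seqP cJ; case: s ss us Js sE => [|a [|b [|c [|]]]] // _ us Js.
  rewrite J0 !big_cons big_nil addr0 addrA => /esym/eqP; rewrite addx_eq0 => /eqP abE.
  have inA z : z \in [:: a; b; c] -> [/\ dot z x = 0, z != 0 & ft E z != 0].
    by rewrite -Js => /(subsetP JA); rewrite !inE /= andbT => /and3P[/eqP].
  have [|ax a0 fa] := inA a; first by rewrite inE eqxx.
  have [|bx b0 fb] := inA b; first by rewrite !inE eqxx orbT.
  have [|cx c0 fc] := inA c; first by rewrite !inE eqxx !orbT.
  (* The plane {0, a, b, a + b} tiles with [L], so its transform vanishes at [x], where [ft L] does
     not; but the plane is orthogonal to [x], so the value is 4. *)
  have [||| dir cS] := @line_direct E L a b sEL; rewrite ?abE //.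
  case/eqP: fLx; have := direct_ft dir _ x0; rewrite cL cS d6 => /(_ erefl)/eqP.
  rewrite mulf_eq0 => /orP[/eqP //|]; rewrite /ft (eq_bigr (fun=> 1)).
    by rewrite sumr_const cS.
  move=> z; rewrite inE chrE dotC !inE => /or4P[]/eqP->; rewrite ?dot0l ?dotDl ?ax ?bx //.
exists (ker [:: x; y]); split; first exact: subspace_ker.
  have le64 := card_ker [:: x; y]; rewrite d6 in le64.
  by rewrite cE -(leq_pmul2l (isT : 0 < 4)%N).
move=> u; rewrite inE /= andbT => /andP[/eqP ux /eqP uy] u0.
apply/eqP; apply: contraT => fu.
by have := yA u; rewrite !inE /= ux u0 fu dotC uy eqxx => /(_ isT).
Qed.

End SpectralGood.

Lemma spectrum_good d (E L : {set 'rV['F_2]_d}) : (d <= 6)%N -> E != set0 ->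
  spectrum E L -> good E.
Proof.
move=> d6 E0 sEL; have [cL orth] := sEL.
have le64 : (2 ^ d <= 64)%N by rewrite (leq_pexp2l (isT : 0 < 2)%N d6).
have [a /andP[a0 fa]|none] := pickP (fun a => (a != 0) && (ft E a != 0)); last first.
  exists setT; split; [exact: subspaceT | by rewrite subset_leq_card ?subsetT |].
  by move=> u _ u0; have := none u; rewrite u0 /= => /negbFE/eqP.
have [half|nhalf] := eqVneq (2 * #|E|)%N (2 ^ d)%N.
  apply: (good_of_half (U := setT) (c := 0) sEL (@subspaceT d)).
    by move=> l _; rewrite inE.
  by rewrite cardsT card_rV cL half.
have [b [b0 ab0 fb fab]] := ft_line nhalf a0 fa.
have [dir cS] := line_direct sEL (And4 a0 fa b0 ab0) fb fab.
have := direct_leq dir; rewrite cS cL => le4.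
have n0 : (0 < #|E|)%N by rewrite card_gt0.
have [n2|n2] := leqP #|E| 2.
  have [n1|n1] : #|E| = (2 ^ 0)%N \/ #|E| = (2 ^ 1)%N by move: n0 n2; clear; lia.
    exact: good_small n1 _.
  exact: good_small n1 _.
(* Three points of [L] suffice: their differences are zeros of [ft E], so [ft_mod4] leaves |E|
   alone. *)
have [m nE] : exists m : int, #|E|%:R = 4 * m.
  have [s [ss us Ls _]] := set_seqP cL; rewrite -ss in n2.
  case: s us Ls n2 {ss} => [|l0 [|l1 [|l2 s]]] us Ls // _.
  have [m mE] := ft_mod4 E (l0 + l1) (l0 + l2); exists m; rewrite -mE.
  have cancel x y z : x + y + (x + z) = y + z :> 'rV['F_2]_d by rewrite addrACA addxx add0r.
  move: us; rewrite /= !inE !negb_or => /and3P[/and3P[n01 n02 _] /andP[n12 _] _].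
  have [L0 L1 L2] : [/\ l0 \in L, l1 \in L & l2 \in L].
    by rewrite !Ls !inE !eqxx !orbT.
  by rewrite cancel (orth l0 l1) // (orth l0 l2) // (orth l1 l2) // !addr0.
have : #|E| \in [:: 4; 8; 12; 16]%N.
  by move: nE le4 le64 n0; move: #|E| => n; clear; rewrite !inE; lia.
rewrite !inE => /or4P[]/eqP cE.
- exact: (good_small (k := 2)).
- exact: good_spectrum8 sEL cE.
- by case: (no_spectrum12 sEL cE).
- apply: (good_spectrum16 sEL cE); apply/eqP; rewrite eqn_leq le64.
  by move: le4; rewrite cE.
Qed.

(** * A spectral set of twelve points *)

(** Words rather than vectors, so that orthogonality can be decided by evaluation. *)
Definition simplex12 : seq bitseq :=
  nseq 10 false :: nseq 10 true :: [seq [seq i == j | j <- iota 0 10] | i <- iota 0 10].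

(* The nonzero words are the rows of the Paley matrix of order 11, with the
   first column deleted. *)
Definition paley12 : seq bitseq :=
  nseq 10 false :: [seq [seq (j + 11 - i) %% 11 \in [:: 0; 2; 6; 7; 8; 10] | j <- iota 1 10]
                   | i <- iota 0 11]%N.

Definition bitdot (s t : bitseq) : nat := count id [seq p.1 && p.2 | p <- zip s t].

Definition bitxor (s t : bitseq) : bitseq := [seq p.1 (+) p.2 | p <- zip s t].

Lemma sgn2_natr n : sgn2 n%:R = (-1) ^+ n.
Proof. by elim: n => [|n IHn] //; rewrite -natr1 sgn2D IHn exprSr. Qed.

Lemma sum_signs (T : Type) (f : T -> nat) (s : seq T) :
  \sum_(x <- s) (-1) ^+ f x = (size s)%:R - 2 * (count (odd \o f) s)%:R :> int.
Proof.
elim: s => [|x s IHs]; first by rewrite big_nil mulr0 subr0.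
rewrite big_cons IHs -signr_odd /=; case: (odd (f x)); rewrite /= ?expr1 ?expr0; lia.
Qed.

Section Counterexample.

Variable d : nat.

(** The default [false] pads short words with zeros up to dimension [d]. *)
Definition vec_of_bits (s : bitseq) : 'rV['F_2]_d := \row_i (nth false s i)%:R.

Lemma dot_bits s t : size s = size t -> (size s <= d)%N ->
  dot (vec_of_bits s) (vec_of_bits t) = (bitdot s t)%:R.
Proof.
move=> st sd; rewrite /dot; transitivity (\sum_(i < d) (nth false s i && nth false t i)%:R : 'F_2).
  by apply: eq_bigr => i _; rewrite !mxE -natrM mulnb.
rewrite -natr_sum; congr _%:R.
elim: s t st (d) sd => [|a s IHs] [|b t] //= => [_|[st]] n.
  by move=> _; rewrite big1 // => i _; rewrite !nth_nil.
by case: n => // n sn; rewrite big_ord_recl /= (IHs t).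
Qed.

Lemma vec_xor s t : size s = size t ->
  vec_of_bits s + vec_of_bits t = vec_of_bits (bitxor s t).
Proof.
move=> st; apply/rowP => i; rewrite !mxE /bitxor.
have [lt_is|le_si] := ltnP i (size s); last first.
  by rewrite !nth_default ?size_map ?size_zip -?st ?minnn ?addr0.
rewrite (nth_map (false, false)) ?size_zip -?st ?minnn // nth_zip //=.
by case: (nth false s i); case: (nth false t i); apply: val_inj.
Qed.

Lemma vec_of_bits_inj k (S : seq bitseq) : (k <= d)%N -> all (fun s => size s == k) S ->
  {in S &, injective vec_of_bits}.
Proof.
move=> kd /allP sS s t /sS/eqP ss /sS/eqP st eq.
apply: (@eq_from_nth _ false) => [|i]; first by rewrite ss st.
rewrite ss => ik; have := congr1 (fun v : 'rV_d => v 0 (Ordinal (leq_trans ik kd))) eq.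
by rewrite !mxE /=; case: (nth _ s i); case: (nth _ t i).
Qed.

Lemma spectrum_of_bits k (S M : seq bitseq) : (k <= d)%N ->
    all (fun s => size s == k) (S ++ M) -> uniq S -> uniq M -> size M = size S ->
    all (fun l => all (fun l' => (l == l') ||
      (2 * count (odd \o bitdot (bitxor l l')) S == size S)%N) M) M ->
  #|[set x in map vec_of_bits S]| = size S /\
  spectrum [set x in map vec_of_bits S] [set x in map vec_of_bits M].
Proof.
move=> kd; rewrite all_cat => /andP[kS kM] uS uM cMS /allP orth.
have uvS : uniq (map vec_of_bits S) by rewrite map_inj_in_uniq //; apply: vec_of_bits_inj kS.
have uvM : uniq (map vec_of_bits M) by rewrite map_inj_in_uniq //; apply: vec_of_bits_inj kM.
have [cS _] := card_sum_set_seq uvS; have [cM _] := card_sum_set_seq uvM.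
split; first by rewrite cS size_map.
split=> [|x y]; first by rewrite cS cM !size_map.
rewrite !inE => /mapP[l lM ->] /mapP[l' l'M ->] ll'.
have sz := allP kS; have szM := allP kM.
have szl := szM l lM; have szl' := szM l' l'M.
rewrite vec_xor ?(eqP szl) ?(eqP szl') // /ft.
transitivity (\sum_(s <- S) (-1) ^+ bitdot (bitxor l l') s : int).
  rewrite (eq_bigl (mem (map vec_of_bits S))) => [|z]; last by rewrite inE.
  rewrite -(big_uniq _ uvS) big_map big_seq [RHS]big_seq; apply: eq_bigr => s sS.
  rewrite /chr -/(sgn2 _) dot_bits ?sgn2_natr // size_map size_zip (eqP szl) (eqP szl') minnn //.
  by rewrite (eqP (sz s sS)).
rewrite sum_signs; have /allP/(_ l' l'M)/orP[/eqP ll|/eqP <-] := orth l lM.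
  by rewrite ll eqxx in ll'.
by rewrite natrM subrr.
Qed.

End Counterexample.

(** The residues in [paley12] are 0 and the non-squares modulo 11. Each circulant row has six ones,
    so the parity of its ten kept bits is the deleted bit: the all-ones point supplies the deleted
    column of the Hadamard matrix, and the point 0 its constant column. *)
Lemma exists_spectrum12 d : (10 <= d)%N ->
  exists E L : {set 'rV['F_2]_d}, #|E| = 12%N /\ spectrum E L.
Proof.
move=> d10; exists [set x in map (vec_of_bits d) simplex12].
exists [set x in map (vec_of_bits d) paley12].
by apply: (@spectrum_of_bits d 10 simplex12 paley12); last vm_compute.
Qed.

Theorem theorem1p2 (R : realType) :
  (forall d : nat, (d <= 6)%N ->
     forall E : {set 'rV['F_2]_d}, E != set0 -> (tiles E <-> spectral R E)) /\
  (forall d : nat, (10 <= d)%N ->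
     exists E : {set 'rV['F_2]_d}, E != set0 /\ ~ (tiles E <-> spectral R E)).
Proof.
split=> d hd.
  move=> E E0; rewrite spectralP; split=> [tE|[L sEL]].
    exact: good_spectrum E0 (tiles_good hd tE).
  exact: good_tiles E0 (spectrum_good hd E0 sEL).
have [E [L [cE sEL]]] := exists_spectrum12 hd.
exists E; split; first by rewrite -card_gt0 cE.
rewrite spectralP => -[_ /(_ (ex_intro _ L sEL))] /tiles_direct[T _ cET].
have : (3 %| 2 ^ d)%N by rewrite -cET cE dvdn_mulr.
by rewrite Euclid_dvdX.
Qed.
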